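(* Let $k\ge 2$ be an integer and $0\le\alpha\le 1$. Let $K\subset\mathbb{R}^n$ be a compact convex set whose interior contains the origin, such that $\partial K$ is $C^{k,\alpha}$ and its principal curvatures are positive at every point. Let $U\subset\mathbb{R}^n$ be a bounded open set with $C^{k,\alpha}$ boundary. Let $\varphi:\mathbb{R}^n\to\mathbb{R}$ be a $C^{k,\alpha}$ function with $\gamma^{\circ}(D\varphi)<1$ everywhere. Suppose $x\in U$, and $y$ is one of the $\rho$-closest points to $x$ on $\partial U$. Suppose $\tilde\kappa$ is an eigenvalue of $W(y):=-D^2\gamma^{\circ}(\mu(y))\,D^2\rho(y)$. Then $$\tilde\kappa\big(\rho(z)-\varphi(y)\big)=\tilde\kappa\,\gamma(z-y)<1$$ for every $z\in\,]x,y[$. As a consequence, for every such $z$, $$\det Q(z)=\det\big(I-\gamma(z-y)W(y)\big)>0.$$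
   Context: Gauge and polar: $\gamma(x):=\inf\{t>0: x\in tK\}$ is the gauge function of $K$; $K^{\circ}:=\{x:\langle x,z\rangle\le 1 \text{ for all } z\in K\}$ is the polar of $K$; $\gamma^{\circ}$ is the gauge function of $K^{\circ}$. Under the stated assumptions $\gamma,\gamma^\circ$ are $C^{k,\alpha}$ on $\mathbb{R}^n\setminus\{0\}$. $]x,y[$ is the open line segment with endpoints $x,y$; $I$ is the identity matrix. Obstacle: $\rho(x):=\min_{z\in\partial U}[\gamma(x-z)+\varphi(z)]$, regarded as a function on $\overline U$. A point $z\in\partial U$ is called a $\rho$-closest point to $x$ on $\partial U$ if $\rho(x)=\gamma(x-z)+\varphi(z)$. Let $\nu$ be the inward unit normal to $\partial U$. For every $y\in\partial U$ there is a unique scalar $\lambda(y)>0$ with $\gamma^{\circ}(D\varphi(y)+\lambda(y)\nu(y))=1$; set $\mu(y):=D\varphi(y)+\lambda(y)\nu(y)$. Under the stated assumptions $\rho$ is $C^{k,\alpha}$ on $\overline U\cap B_r(y)$ for some $r>0$ for every $y\in\partial U$; $D^2\rho(y)$ for $y\in\partial U$ denotes the Hessian of $\rho|_{\overline U}$ at $y$ (the limit of $D^2\rho$ from inside $U$). For a point $z\in U$ with unique $\rho$-closest point $y$, $Q(z):=I-(\rho(z)-\varphi(y))W(y)$. *)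

(* Defs.v *)
(* MathComp-Analysis; R^n is the space 'rV[R]_n of row vectors over R : realType.
   The library norm on 'rV[R]_n is the sup norm.  It is used only for topology and
   for local Hoelder estimates, which do not depend on the choice of the norm; unit
   normals refer to the Euclidean norm [enorm]. *)
From HB Require Import structures.
From mathcomp Require Import all_boot all_order all_algebra.
From mathcomp Require Import all_classical all_reals all_analysis.

Set Implicit Arguments.
Unset Strict Implicit.
Unset Printing Implicit Defensive.

Import Order.TTheory GRing.Theory Num.Theory.
Import numFieldNormedType.Exports.

Local Open Scope classical_set_scope.
Local Open Scope ring_scope.

Section calculus.
Context {R : realType} {n : nat}.
Local Notation V := 'rV[R]_n.
Implicit Types (f : V -> R) (A D : set V) (p q v : V).

Definition dotp (u v : V) : R := \sum_i u 0 i * v 0 i.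
Definition enorm v : R := Num.sqrt (dotp v v).

Definition partial (i : 'I_n) f : V -> R := 'D_(delta_mx 0 i) f.
Definition grad f p : V := \row_i partial i f p.
Definition hess f p : 'M[R]_n := \matrix_(i, j) partial i (partial j f) p.

(* Since [powR 0 0 = 1], for a = 0 this is local boundedness of the differences, hence
   no condition on a continuous function: the classes C^{k,0} and C^k below coincide. *)
Definition locally_hoelder (a : R) D f : Prop :=
  forall p, D p -> exists2 r : R, 0 < r & exists C : R,
    forall q q', D q -> D q' -> ball p r q -> ball p r q' ->
      `|f q - f q'| <= C * `|q - q'| `^ a.

(* f is C^{k,a} on the open set D; Hoelder continuity is required locally in D. *)
Fixpoint holder_class (k : nat) (a : R) D f : Prop :=
  match k with
  | 0 => (forall p, D p -> {for p, continuous f}) /\ locally_hoelder a D f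
  | k'.+1 => (forall p, D p -> {for p, continuous f}) /\
      forall i, (forall p, D p -> derivable f p (delta_mx 0 i)) /\
                holder_class k' a D (partial i f)
  end.

Definition boundary A : set V := closure A `\` A°.

(* f is a C^{k,a} defining function of A near p: near p the boundary of A is the regular
   level set {f = 0}, and A lies on the side {f > 0}. *)
Definition local_defining_function (k : nat) (a : R) A p f : Prop :=
  exists2 r : R, 0 < r &
    [/\ holder_class k a (ball p r) f,
        grad f p != 0,
        (forall q, ball p r q -> (A° q <-> 0 < f q)) &
        (forall q, ball p r q -> (boundary A q <-> f q = 0))].

Definition holder_boundary (k : nat) (a : R) A : Prop :=
  forall p, boundary A p -> exists f, local_defining_function k a A p f.

(* For a defining function f of A, normalize (grad f q) is the inward unit normal at
   each boundary point q near p. *)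
Definition normalize v : V := (enorm v)^-1 *: v.

Definition is_inward_unit_normal A p v : Prop :=
  exists2 f, local_defining_function 1 0 A p f & v = normalize (grad f p).

(* c is an eigenvalue of the Weingarten map of the boundary of A at p, that is, of the
   derivative of the OUTWARD unit normal field along tangent vectors; with this sign
   the principal curvatures of a ball of radius r are 1/r. *)
Definition is_principal_curvature A p (c : R) : Prop :=
  exists2 f, local_defining_function 2 0 A p f &
    exists v, [/\ v != 0, dotp v (grad f p) = 0 &
                  'D_v (fun q => - normalize (grad f q)) p = c *: v].

Definition gauge A : V -> R :=
  fun x => inf [set t | 0 < t /\ [set t *: z | z in A] x].

Definition polar A : set V := [set x | forall z, A z -> dotp x z <= 1].

Definition open_segment (x y : V) : set V :=
  [set (1 - t) *: x + t *: y | t in [set t : R | 0 < t < 1]].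

End calculus.

(* The objects below that are determined by a defining property are given by [xget 0],
   the choice of an element with that property. *)
Section obstacle.
Context {R : realType} {n : nat}.
Local Notation V := 'rV[R]_n.
Variables (K U : set V) (phi : V -> R).

Definition rho (x : V) : R :=
  inf [set gauge K (x - z) + phi z | z in boundary U].

Definition rho_closest (x z : V) : Prop :=
  boundary U z /\ rho x = gauge K (x - z) + phi z.

Definition nu (y : V) : V := xget 0 [set v | is_inward_unit_normal U y v].

Definition lambda (y : V) : R :=
  xget 0 [set l : R | 0 < l /\ gauge (polar K) (grad phi y + l *: nu y) = 1].

Definition mu (y : V) : V := grad phi y + lambda y *: nu y.

Definition is_boundary_hessian (f : V -> R) (y : V) (H : 'M[R]_n) : Prop :=
  (exists2 r : R, 0 < r & holder_class 2 0 (U `&` ball y r) f) /\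
  hess f w @[w --> within U (nbhs y)] --> H.

Definition hess_rho (y : V) : 'M[R]_n := xget 0 [set H | is_boundary_hessian rho y H].

Definition W (y : V) : 'M[R]_n := - hess (gauge (polar K)) (mu y) *m hess_rho y.

(* Meant for points z of U having a unique rho-closest point. *)
Definition Q (z : V) : 'M[R]_n :=
  let y := xget 0 [set y | rho_closest z y] in
  1%:M - (rho z - phi y) *: W y.

End obstacle.

(* Main.v *)
(* Write h for the gauge of the polar of K, that is, the support function of K, T = gauge K (x - y)
   and z0 = (x - y) / T, and let argmax p be the maximizer of <p, .> over K, unique since the
   principal curvatures of K are positive.  Then argmax is the gradient of h, and it is
   differentiable at the conormal m of K at z0 normalized by <m, z0> = 1, with m = mu y and
   A = D^2 h (m).
   By the triangle inequality rho w >= rho x - gauge K (x - w), with equality on the segment from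
   x to y.  Comparing both sides along the paths w(s) = x - T_z argmax (m - s v), where z is on
   the segment and T_z = gauge K (x - z), gives to second order in s
     <v A, v> + T_z <v A D^2 rho (z), v A> >= 0,
   and z -> y yields the same inequality with T and D^2 rho (y).  If v W = c v with c > 0, then
   v A D^2 rho (y) = - c v, hence (1 - c T) <v A, v> >= 0.  Here <v A, v> > 0, since otherwise
   v A = 0 and c v = 0; so c T <= 1, and gauge K (z - y) < T for z strictly between x and y. *)
Require Import Defs.
From HB Require Import structures.
From mathcomp Require Import all_boot all_order all_algebra.
From mathcomp Require Import all_classical all_reals all_analysis.
From mathcomp Require Import ring lra.

Import Order.TTheory GRing.Theory Num.Theory.
Import numFieldNormedType.Exports.

Local Open Scope classical_set_scope.
Local Open Scope ring_scope.

Set Implicit Arguments.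
Unset Strict Implicit.
Unset Printing Implicit Defensive.

(** * Linear algebra and norms on row vectors *)

(** The comparison paths are built on the dual side, from argmax, because A cannot be inverted: h is
    homogeneous of degree one, so A annihilates m. A path with velocity proportional to v A
    evaluates D^2 rho exactly at the vector to which the eigenvalue equation applies.
    Differentiability of argmax is obtained directly from a C^2 defining function of K: the normals
    at neighbouring boundary points are linearized, and the linear map acting on the increments is
    invertible because a kernel vector would be a tangent direction of zero principal curvature. At
    y the Hessian of rho exists only as a limit from inside U, so the inequality is first proved at
    interior points of the segment, where rho can be expanded along a path in any direction. The
    identity m = mu y needs the full normal component of m - D phi (y), with its sign. Both come
    from comparing y with points outside U. The determinant is treated with real eigenvalues alone,
    as a polynomial in the parameter that multiplies W. *)

Section dot_product.
Context {R : realType} {n : nat}.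
Local Notation V := 'rV[R]_n.
Implicit Types (u v w : V) (c : R).

Lemma dotpC u v : dotp u v = dotp v u.
Proof. by apply: eq_bigr => i _; rewrite mulrC. Qed.

Lemma dotpDl u v w : dotp (u + v) w = dotp u w + dotp v w.
Proof. by rewrite -big_split; apply: eq_bigr => i _; rewrite mxE mulrDl. Qed.

Lemma dotpZl c u w : dotp (c *: u) w = c * dotp u w.
Proof. by rewrite /dotp mulr_sumr; apply: eq_bigr => i _; rewrite mxE mulrA. Qed.

Lemma dotpNl u w : dotp (- u) w = - dotp u w.
Proof. by rewrite -scaleN1r dotpZl mulN1r. Qed.

Lemma dotpBl u v w : dotp (u - v) w = dotp u w - dotp v w.
Proof. by rewrite dotpDl dotpNl. Qed.

Lemma dotp0l w : dotp 0 w = 0.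
Proof. by rewrite -(scale0r 0) dotpZl mul0r. Qed.

Lemma dotpDr u v w : dotp w (u + v) = dotp w u + dotp w v.
Proof. by rewrite !(dotpC w) dotpDl. Qed.

Lemma dotpZr c u w : dotp w (c *: u) = c * dotp w u.
Proof. by rewrite !(dotpC w) dotpZl. Qed.

Lemma dotpNr u w : dotp w (- u) = - dotp w u.
Proof. by rewrite !(dotpC w) dotpNl. Qed.

Lemma dotpBr u v w : dotp w (u - v) = dotp w u - dotp w v.
Proof. by rewrite !(dotpC w) dotpBl. Qed.

Lemma dotp0r w : dotp w 0 = 0.
Proof. by rewrite dotpC dotp0l. Qed.

Lemma dotp_ge0 u : 0 <= dotp u u.
Proof. by apply: sumr_ge0 => i _; rewrite -expr2 sqr_ge0. Qed.

Lemma dotp_eq0 u : dotp u u = 0 -> u = 0.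
Proof.
move=> u0; apply/rowP => i; rewrite mxE; apply/eqP.
have /eqP := u0; rewrite /dotp psumr_eq0; last by move=> j _; rewrite -expr2 sqr_ge0.
by move=> /allP/(_ i); rewrite mem_index_enum => /(_ isT)/=; rewrite mulf_eq0 orbb.
Qed.

Lemma dotp_gt0 u : u != 0 -> 0 < dotp u u.
Proof.
move=> u0; rewrite lt_neqAle dotp_ge0 andbT eq_sym.
by apply: contra u0 => /eqP/dotp_eq0/eqP.
Qed.

Lemma dotp1_neq0 u v : dotp u v = 1 -> u != 0.
Proof. by move=> uv; apply: contra_eq_neq uv => ->; rewrite dotp0l eq_sym oner_neq0. Qed.

Lemma dotp_delta u i : dotp u (delta_mx 0 i) = u 0 i.
Proof.
rewrite /dotp (bigD1 i)//= mxE !eqxx mulr1 big1 ?addr0// => j ji.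
by rewrite mxE (negbTE ji) andbF mulr0.
Qed.

Lemma enorm_gt0 u : u != 0 -> 0 < enorm u.
Proof. by move=> u0; rewrite sqrtr_gt0 dotp_gt0. Qed.

Lemma enormZ c u : 0 <= c -> enorm (c *: u) = c * enorm u.
Proof.
move=> c0; rewrite /enorm dotpZl dotpZr mulrA -expr2 sqrtrM ?sqr_ge0//.
by rewrite sqrtr_sqr ger0_norm.
Qed.

Lemma normalizeZ c u : 0 < c -> normalize (c *: u) = normalize u.
Proof.
by move=> c0; rewrite /normalize enormZ ?ltW// scalerA invfM mulrAC mulVf ?gt_eqF// mul1r.
Qed.

Lemma ler_coord_norm u i : `|u 0 i| <= `|u|.
Proof.
by rewrite [leRHS]/Num.Def.normr/= mx_normrE; apply: (le_bigmax _ _ (0, i)).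
Qed.

Lemma norm_rV_le u c : 0 <= c -> (forall i, `|u 0 i| <= c) -> `|u| <= c.
Proof.
move=> c0 uc; rewrite [leLHS]/Num.Def.normr/= mx_normrE.
by apply: bigmax_le => // -[i j] _ /=; rewrite ord1.
Qed.

Lemma norm_dotp_le u v : `|dotp u v| <= n%:R * `|u| * `|v|.
Proof.
rewrite /dotp (le_trans (ler_norm_sum _ _ _))//.
rewrite -mulrA -[X in X%:R * _]card_ord mulr_natl -sumr_const.
by apply: ler_sum => i _; rewrite normrM ler_pM// ler_coord_norm.
Qed.

Lemma norm_mulmx u (B : 'M[R]_n) : `|u *m B| <= n%:R * `|u| * `|B|.
Proof.
apply: norm_rV_le => [|j]; first by rewrite !mulr_ge0.
rewrite mxE (le_trans (ler_norm_sum _ _ _))//.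
rewrite -mulrA -[X in X%:R * _]card_ord mulr_natl -sumr_const.
apply: ler_sum => i _; rewrite normrM ler_pM ?ler_coord_norm//.
by rewrite [leRHS]/Num.Def.normr/= mx_normrE; apply: (le_bigmax _ _ (i, j)).
Qed.

Lemma norm_mulmx_le (B : 'M[R]_n) : exists2 C, 0 < C & forall u, `|u *m B| <= C * `|u|.
Proof.
exists (n%:R * `|B| + 1) => [|u]; first by rewrite ltr_wpDl// mulr_ge0.
rewrite (le_trans (norm_mulmx _ _))// mulrDl mul1r mulrAC lerDl//.
Qed.

Lemma near_dist v c : 0 < c -> \forall w \near v, `|v - w| < c.
Proof. by move=> c0; have := nbhsx_ballx v c c0; rewrite -ball_normE. Qed.

Lemma near0_norm c : 0 < c -> \forall d \near (0 : V), `|d| < c.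
Proof. exact: nbhs0_lt. Qed.

Lemma near_norm_addr v (P : set V) :
  (\forall w \near v, P w) <-> \forall d \near (0 : V), P (v + d).
Proof.
rewrite (near_shift 0) subr0; split; apply: filterS => d /=; by rewrite addrC.
Qed.

Lemma dotp_continuous u : continuous (dotp u : V -> R).
Proof.
move=> v; apply/(@cvgrPdist_le _ _ _ _ (@nbhs_filter V v)) => e e0.
have C0 : 0 < n%:R * `|u| + 1 by rewrite ltr_pwDr// mulr_ge0.
near=> w.
rewrite -dotpBr (le_trans (norm_dotp_le _ _))//.
apply: (@le_trans _ _ ((n%:R * `|u| + 1) * `|v - w|)).
  by rewrite ler_wpM2r// lerDl.
rewrite mulrC -ler_pdivlMr// ltW//; near: w; apply: near_dist.
by rewrite divr_gt0.
Unshelve. all: by end_near. Qed.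

Lemma cvg_dotp {T : Type} {F : set_system T} {FF : Filter F} (a b : T -> V) u v :
  a x @[x --> F] --> u -> b x @[x --> F] --> v ->
  dotp (a x) (b x) @[x --> F] --> dotp u v.
Proof.
move=> au bv; rewrite /dotp.
have coord w (c : T -> V) i : c x @[x --> F] --> w -> c x 0 i @[x --> F] --> w 0 i.
  move=> cw; have := cvg_comp _ _ cw (@coord_continuous R 1 n 0 i w); exact.
apply: cvg_big => [|i _]; first exact: add_continuous.
by apply: cvgM; apply: coord.
Qed.

Lemma mulmx_continuous (B : 'M[R]_n) : continuous (fun u : V => u *m B : V).
Proof.
move=> v; have [C C0 HC] := norm_mulmx_le B.
apply/(@cvgrPdist_le _ _ _ _ (@nbhs_filter V v)) => e e0; near=> w.
rewrite -mulmxBl (le_trans (HC _))// mulrC -ler_pdivlMr// ltW//.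
by near: w; apply: near_dist; rewrite divr_gt0.
Unshelve. all: by end_near. Qed.

End dot_product.

(** * Frechet derivatives *)

Section calculus_on_rows.
Context {R : realType} {n : nat}.
Local Notation V := 'rV[R]_n.
Implicit Types (f : V -> R) (p q v g d : V) (t e : R).

Lemma is_derive_line f p v t df :
  is_derive (p + t *: v) v f df <-> is_derive t 1 (fun s : R => f (p + s *: v)) df.
Proof.
have E : (fun h : R => h^-1 *: ((f \o shift (p + t *: v)) (h *: v) - f (p + t *: v))) =
    (fun h : R => h^-1 *: (((fun s : R => f (p + s *: v)) \o shift t) (h *: (1 : R)) -
       f (p + t *: v))).
  apply/funext => h /=; congr (_ *: (f _ - _)).
  by rewrite addrC -addrA -scalerDl [h *: 1]mulr1 [t + h]addrC.
split=> -[D1 D2]; apply: DeriveDef.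
- by move: D1; rewrite /derivable E.
- by rewrite -D2 /derive E.
- by move: D1; rewrite /derivable E.
- by rewrite -D2 /derive E.
Qed.

Lemma is_derive_scale f p v (c df : R) :
  is_derive p v f df -> is_derive p (c *: v) f (c * df).
Proof.
move=> fv.
suff : is_derive (p + 0 *: (c *: v)) (c *: v) f (c * df) by rewrite scale0r addr0.
apply/is_derive_line.
have fv' : is_derive (c * 0) 1 (fun s : R => f (p + s *: v)) df.
  by apply/is_derive_line; rewrite mulr0 scale0r addr0.
have lin : is_derive (0 : R) 1 (fun s : R => c * s) c.
  by apply: is_derive_eq; rewrite [_%:A]mulr1.
have -> : (fun s : R => f (p + s *: (c *: v))) = (fun s : R => f (p + s *: v)) \o (fun s => c * s).
  by apply/funext => s /=; rewrite scalerA [s * c]mulrC.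
by apply: is_derive_eq (is_derive1_comp fv' lin) _; rewrite mulrC.
Qed.

Lemma MVT_line f p v (df : R -> R) :
  (forall t, 0 <= t <= 1 -> is_derive (p + t *: v) v f (df t)) ->
  exists2 t, 0 <= t <= 1 & f (p + v) - f p = df t.
Proof.
move=> fv; pose F (s : R) := f (p + s *: v).
have dF t : 0 <= t <= 1 -> is_derive t 1 F (df t).
  by move=> t01; apply/is_derive_line/fv.
have cF : {within `[0, 1]%classic, continuous F}.
  apply: derivable_within_continuous => t; rewrite in_itv/= => t01.
  by have [] := dF _ t01.
have dF' t : t \in `]0%R, 1%R[ -> is_derive t 1 F (df t).
  by rewrite in_itv/= => /andP[t0 t1]; apply: dF; rewrite !ltW.
have [t] := MVT_segment ler01 dF' cF.
rewrite in_itv/= subr0 mulr1 /F scale1r scale0r addr0 => t01 ?.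
by exists t.
Qed.

Definition has_grad f p g :=
  forall e, 0 < e -> \forall d \near (0 : V), `|f (p + d) - f p - dotp g d| <= e * `|d|.

(** Increments are rows and [J] acts on the right, so its entry (i, j) is the i-th partial
    derivative of the j-th coordinate. This makes [hess] the Jacobian of [grad] without a
    transpose. *)
Definition has_jac (F : V -> V) p (J : 'M[R]_n) :=
  forall e, 0 < e -> \forall d \near (0 : V), `|F (p + d) - F p - d *m J| <= e * `|d|.

Lemma has_grad_is_derive f p g v : has_grad f p g -> is_derive p v f (dotp g v).
Proof.
move=> fg.
suff H : (fun h : R => h^-1 *: ((f \o shift p) (h *: v) - f p)) @ 0^' --> dotp g v.
  by apply: DeriveDef; [apply/cvg_ex; eexists; exact: H | apply: cvg_lim].
apply/cvgrPdist_le => e e0.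
have v0 : 0 < `|v| + 1 by rewrite ltr_pwDr.
have cs : (h *: v : V) @[h --> (0 : R)^'] --> (0 : V).
  rewrite -[X in _ --> X](scale0r v).
  by apply: cvgZr_tmp; apply: cvg_within.
have := cs _ (fg (e / (`|v| + 1)) (divr_gt0 e0 v0)); rewrite /nbhs/= => nf.
near=> h.
have h0 : h != 0 by near: h; exact: nbhs_dnbhs_neq.
have : `|f (p + h *: v) - f p - dotp g (h *: v)| <= e / (`|v| + 1) * `|h *: v|.
  by near: h; exact: nf.
rewrite dotpZr normrZ => H; rewrite distrC /= [h *: v + p]addrC.
have -> : h^-1 *: (f (p + h *: v) - f p) - dotp g v =
    h^-1 * (f (p + h *: v) - f p - h * dotp g v).
  by rewrite mulrBr mulKf.
rewrite normrM normfV mulrC ler_pdivrMr ?normr_gt0//.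
apply: (le_trans H); rewrite mulrCA mulrC ler_wpM2r//.
by rewrite mulrAC ler_pdivrMr// ler_wpM2l ?ltW// ltrDl.
Unshelve. all: by end_near. Qed.

Lemma has_grad_derive f p g v : has_grad f p g -> 'D_v f p = dotp g v.
Proof. by move=> /(has_grad_is_derive v)[]. Qed.

Lemma C1_has_grad f p :
  (\forall q \near p, forall i, derivable f q (delta_mx 0 i)) ->
  (forall i, {for p, continuous (partial i f)}) -> has_grad f p (grad f p).
Proof.
move=> df cf e e0.
have e'0 : 0 < e / n.+1%:R by rewrite divr_gt0.
have : \forall q \near p, (forall i, derivable f q (delta_mx 0 i)) /\
    (forall i, `|partial i f p - partial i f q| <= e / n.+1%:R).
  apply: filterI => //; apply: (@filter_forall _ _ _ (nbhs p)) => i.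
  by have /(@cvgrPdist_le _ _ _ _ (@nbhs_filter V p)) := cf i; apply.
move=> /nbhs_ballP[r /= r0]; rewrite -ball_normE => Hr.
near=> d.
have dr : `|d| < r by near: d; exact: near0_norm.
(* The truncations [pre k] form a staircase from 0 to [d]; each step follows one axis, where the
   mean value theorem involves a single partial derivative. The share [e / n.+1%:R] of each step
   also makes sense in dimension 0. *)
pose pre k : V := \row_j (if (j < k)%N then d 0 j else 0).
have pre0 : pre 0 = 0 by apply/rowP => j; rewrite !mxE.
have pren : pre n = d by apply/rowP => j; rewrite !mxE ltn_ord.
have preS (i : 'I_n) : pre i.+1 = pre i + d 0 i *: delta_mx 0 i.
  apply/rowP => j; rewrite !mxE eqxx/= ltnS leq_eqVlt -(inj_eq val_inj)/=.
  by case: ltngtP => //= ij; rewrite ?mulr0 ?mulr1 ?addr0 ?add0r//; congr (d 0 _); apply/val_inj.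
have key (i : 'I_n) : `|f (p + pre i.+1) - f (p + pre i) - partial i f p * d 0 i| <=
    e / n.+1%:R * `|d|.
  have step t : 0 <= t <= 1 -> `|p - (p + (pre i + t *: (d 0 i *: delta_mx 0 i)))| < r.
    move=> /andP[t0 t1]; rewrite opprD addNKr normrN (le_lt_trans _ dr)//.
    apply: norm_rV_le => // j; rewrite !mxE eqxx/=.
    case: (ltngtP j i) => ij.
    - have -> : (j == i) = false by rewrite -(inj_eq val_inj)/= ltn_eqF.
      by rewrite !mulr0 addr0 ler_coord_norm.
    - have -> : (j == i) = false by rewrite -(inj_eq val_inj)/= gtn_eqF.
      by rewrite !mulr0 addr0 normr0.
    - have -> : j = i by apply/val_inj.
      rewrite eqxx mulr1 add0r normrM ger0_norm// (le_trans _ (ler_coord_norm d i))//.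
      by rewrite ler_piMl.
  have der t : 0 <= t <= 1 -> is_derive (p + pre i + t *: (d 0 i *: delta_mx 0 i))
      (d 0 i *: delta_mx 0 i) f
      (d 0 i * partial i f (p + pre i + t *: (d 0 i *: delta_mx 0 i))).
    move=> t01; apply: is_derive_scale; apply: derivableP.
    by have [+ _] := Hr _ (step _ t01); rewrite addrA.
  have [t t01] := MVT_line der.
  rewrite -addrA -preS => ->; rewrite mulrC -mulrBl normrM.
  rewrite ler_pM ?ler_coord_norm// distrC.
  by have [_ +] := Hr _ (step _ t01); rewrite addrA.
have -> : f (p + d) - f p - dotp (grad f p) d =
    \sum_(i < n) (f (p + pre i.+1) - f (p + pre i) - partial i f p * d 0 i).
  rewrite big_split/= -(big_mkord xpredT (fun i => f (p + pre i.+1) - f (p + pre i))).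
  rewrite telescope_sumr// pren pre0 addr0 sumrN; congr (_ - _).
  by apply: eq_bigr => i _; rewrite mxE.
rewrite (le_trans (ler_norm_sum _ _ _))// (le_trans (ler_sum _ (fun i _ => key i)))//.
rewrite sumr_const card_ord -[leLHS]mulr_natl mulrA ler_wpM2r//.
by rewrite mulrCA ler_piMr ?ltW// ltr_pdivrMr// mul1r ltr_nat.
Unshelve. all: by end_near. Qed.

Lemma has_jac_rows (F : V -> V) p (J : 'M[R]_n) :
  (forall j, has_grad (fun q => F q 0 j) p (col j J)^T) -> has_jac F p J.
Proof.
move=> FJ e e0.
have : \forall d \near (0 : V), forall j,
    `|F (p + d) 0 j - F p 0 j - dotp (col j J)^T d| <= e * `|d|.
  by apply: (@filter_forall _ _ _ (nbhs (0 : V))) => j; exact: FJ.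
apply: filterS => d H; apply: norm_rV_le => [|j].
  by rewrite mulr_ge0// ltW.
have -> : (F (p + d) - F p - d *m J) 0 j = F (p + d) 0 j - F p 0 j - dotp (col j J)^T d.
  by rewrite !mxE dotpC; congr (_ - _); apply: eq_bigr => i _; rewrite !mxE.
exact: H.
Qed.

Lemma has_jac_cvg (F : V -> V) p (J : 'M[R]_n) v : has_jac F p J ->
  s^-1 *: (F (p + s *: v) - F p) @[s --> (0 : R)^'] --> v *m J.
Proof.
move=> FJ; apply/cvgrPdist_le => e e0.
have v0 : 0 < `|v| + 1 by rewrite ltr_pwDr.
have cs : (h *: v : V) @[h --> (0 : R)^'] --> (0 : V).
  rewrite -[X in _ --> X](scale0r v).
  by apply: cvgZr_tmp; apply: cvg_within.
have := cs _ (FJ (e / (`|v| + 1)) (divr_gt0 e0 v0)); rewrite /nbhs/= => nf.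
near=> h.
have h0 : h != 0 by near: h; exact: nbhs_dnbhs_neq.
have : `|F (p + h *: v) - F p - (h *: v) *m J| <= e / (`|v| + 1) * `|h *: v|.
  by near: h; exact: nf.
rewrite normrZ -scalemxAl => H; rewrite distrC.
have -> : h^-1 *: (F (p + h *: v) - F p) - v *m J =
    h^-1 *: (F (p + h *: v) - F p - h *: (v *m J)).
  by rewrite [in RHS]scalerBr scalerA mulVf// scale1r.
rewrite normrZ normfV mulrC ler_pdivrMr ?normr_gt0//.
apply: (le_trans H); rewrite mulrCA mulrC ler_wpM2r//.
by rewrite mulrAC ler_pdivrMr// ler_wpM2l ?ltW// ltrDl.
Unshelve. all: by end_near. Qed.

End calculus_on_rows.

(** * Second-order Taylor expansions *)

Section second_order.
Context {R : realType} {n : nat}.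
Local Notation V := 'rV[R]_n.
Implicit Types (f : V -> R) (p q v g d : V) (t e : R).

Lemma is_derive_lin (a t : R) : is_derive t 1 (fun s : R => a * s) a.
Proof. by apply: (is_derive_eq (is_deriveZ a (is_derive_id t (1 : R)))); rewrite [_ *: _]mulr1. Qed.

Lemma is_derive_sq (b t : R) : is_derive t 1 (fun s : R => b * (s * s)) (b * (2 * t)).
Proof.
have E := is_deriveZ b (is_deriveM (is_derive_id t (1 : R)) (is_derive_id t (1 : R))).
by apply: (is_derive_eq E); rewrite [t *: 1]mulr1 mulr2n mulrDl !mul1r.
Qed.

Lemma near0_ball (P : set V) : (\forall d \near (0 : V), P d) ->
  exists2 r, 0 < r & forall d, `|d| < r -> P d.
Proof.
move=> /nbhs_ballP[r /= r0]; rewrite -ball_normE => Hr; exists r => // d dr.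
by apply: Hr => /=; rewrite sub0r normrN.
Qed.

(** The mean value theorem is applied along [d] to [f] minus its quadratic model; the derivative of
    this difference is the first-order remainder of [G], paired with [d]. *)
Lemma taylor2_norm f (G : V -> V) p (J : 'M[R]_n) :
  (\forall q \near p, forall d, is_derive q d f (dotp (G q) d)) -> has_jac G p J ->
  forall e, 0 < e -> \forall d \near (0 : V),
    `|f (p + d) - f p - dotp (G p) d - 2^-1 * dotp (d *m J) d| <= e * `|d| ^+ 2.
Proof.
move=> /near_norm_addr/near0_ball[r1 r10 fG] GJ e e0.
have e'0 : 0 < e / n.+1%:R by rewrite divr_gt0.
have /near0_ball[r2 r20 {}GJ] := GJ _ e'0.
near=> d.
have d1 : `|d| < r1 by near: d; exact: near0_norm.
have d2 : `|d| < r2 by near: d; exact: near0_norm.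
pose a := dotp (G p) d; pose b := 2^-1 * dotp (d *m J) d.
pose F : R -> R := (fun s => f (p + s *: d)) - (fun s => a * s) - (fun s => b * (s * s)).
have td t : 0 <= t <= 1 -> `|t *: d| <= `|d|.
  by move=> /andP[t0 t1]; rewrite normrZ ger0_norm// ler_piMl.
have dF t : 0 <= t <= 1 -> is_derive t 1 F (dotp (G (p + t *: d) - G p - (t *: d) *m J) d).
  move=> t01.
  have fd : is_derive t 1 (fun s => f (p + s *: d)) (dotp (G (p + t *: d)) d).
    by apply/is_derive_line/fG/(le_lt_trans (td _ t01)).
  apply: is_derive_eq (is_deriveB (is_deriveB fd (is_derive_lin a t)) (is_derive_sq b t)) _.
  by rewrite !dotpBl -scalemxAl dotpZl /a /b; field.
have cF : {within `[0, 1]%classic, continuous F}.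
  apply: derivable_within_continuous => t; rewrite in_itv/= => t01.
  by have [] := dF _ t01.
have dF' t : t \in `]0%R, 1%R[ ->
    is_derive t 1 F (dotp (G (p + t *: d) - G p - (t *: d) *m J) d).
  by rewrite in_itv/= => /andP[t0 t1]; apply: dF; rewrite !ltW.
have [t] := MVT_segment ler01 dF' cF.
rewrite in_itv/= subr0 mulr1 => t01 E.
have -> : f (p + d) - f p - dotp (G p) d - 2^-1 * dotp (d *m J) d = F 1 - F 0.
  rewrite /F -/a -/b !fctE scale1r scale0r addr0 !mulr1 !mulr0 !subr0.
  by ring.
rewrite E (le_trans (norm_dotp_le _ _))//.
have := GJ _ (le_lt_trans (td _ t01) d2) => H.
rewrite expr2 mulrA ler_wpM2r//.
apply: (@le_trans _ _ (n%:R * (e / n.+1%:R * `|d|))).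
  by rewrite ler_wpM2l// (le_trans H)// ler_wpM2l ?td// ltW.
by rewrite mulrA ler_wpM2r// mulrCA ler_piMr ?ltW// ltr_pdivrMr// mul1r ltr_nat.
Unshelve. all: by end_near. Qed.

(** The increment follows a curve: the linear term keeps [D s] instead of its limit, since the
    bending of the curve contributes to it at order s^2. *)
Lemma taylor2_cvg f (G : V -> V) p (J : 'M[R]_n) (D : R -> V) (D0 : V) :
  (\forall q \near p, forall d, is_derive q d f (dotp (G q) d)) -> has_jac G p J ->
  D s @[s --> (0 : R)^'] --> D0 ->
  (f (p + s *: D s) - f p - s * dotp (G p) (D s)) / s ^+ 2 @[s --> (0 : R)^'] -->
    2^-1 * dotp (D0 *m J) D0.
Proof.
move=> fG GJ DD.
have sD : (s *: D s : V) @[s --> (0 : R)^'] --> (0 : V).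
  rewrite -[X in _ --> X](scale0r D0).
  by apply: cvgZ => //; exact: cvg_within.
have qD : 2^-1 * dotp (D s *m J) (D s) @[s --> (0 : R)^'] --> 2^-1 * dotp (D0 *m J) D0.
  apply: cvgMl_tmp; apply: cvg_dotp => //.
  exact: (cvg_comp D (fun u : V => u *m J : V) DD (@mulmx_continuous R n J D0)).
suff H : (f (p + s *: D s) - f p - s * dotp (G p) (D s)) / s ^+ 2 -
    2^-1 * dotp (D s *m J) (D s) @[s --> (0 : R)^'] --> (0 : R).
  rewrite -[X in _ --> X]add0r.
  apply: cvg_trans (cvgD H qD); apply: near_eq_cvg.
  by near=> s; rewrite /= subrK.
apply/cvgrPdist_le => e e0.
have C0 : 0 < (`|D0| + 1) ^+ 2 by rewrite exprn_gt0// ltr_pwDr.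
have nf := sD _ (taylor2_norm fG GJ (divr_gt0 e0 C0)).
rewrite /nbhs/= in nf.
near=> s.
have s0 : s != 0 by near: s; exact: nbhs_dnbhs_neq.
have : `|f (p + s *: D s) - f p - dotp (G p) (s *: D s) -
    2^-1 * dotp ((s *: D s) *m J) (s *: D s)| <= e / (`|D0| + 1) ^+ 2 * `|s *: D s| ^+ 2.
  by near: s; exact: nf.
have Ds : `|D s| <= `|D0| + 1.
  rewrite -[D s](subrK D0) (le_trans (ler_normD _ _))// addrC lerD2l distrC.
  by near: s; move/cvgrPdist_le : DD; apply.
rewrite sub0r normrN -scalemxAl !dotpZr dotpZl => H.
have -> : (f (p + s *: D s) - f p - s * dotp (G p) (D s)) / s ^+ 2 -
    2^-1 * dotp (D s *m J) (D s) =
    (f (p + s *: D s) - f p - s * dotp (G p) (D s) -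
    2^-1 * (s * (s * dotp (D s *m J) (D s)))) / s ^+ 2.
  by field.
rewrite normrM normfV normrX ler_pdivrMr ?exprn_gt0 ?normr_gt0//.
apply: (le_trans H); rewrite normrZ exprMn mulrCA mulrC ler_wpM2r ?sqr_ge0//.
rewrite mulrAC ler_pdivrMr// ler_wpM2l ?(ltW e0)//.
by rewrite lerXn2r// nnegrE.
Unshelve. all: by end_near. Qed.

End second_order.

(** * Hoelder classes, defining functions and unit normals *)

Section smooth_functions.
Context {R : realType} {n : nat}.
Local Notation V := 'rV[R]_n.
Implicit Types (f : V -> R) (p q v g d : V) (t e : R) (A D : set V).

Lemma holder_class_continuous k a D f p : holder_class k a D f -> D p -> {for p, continuous f}.
Proof. by case: k => [[cf _]|k [cf _]]; exact: cf. Qed.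

Lemma locally_hoelder0 D f : (forall p, D p -> {for p, continuous f}) -> locally_hoelder 0 D f.
Proof.
move=> cf p Dp.
have /(@cvgrPdist_le _ _ _ _ (@nbhs_filter V p))/(_ _ ltr01)/nbhs_ballP[r /= r0 fr] := cf _ Dp.
exists r => //; exists 2 => q q' _ _ qr q'r; rewrite powRr0 mulr1.
rewrite -[f q](subrK (f p)) -addrA (le_trans (ler_normD _ _))// distrC.
have := fr _ qr; have := fr _ q'r => /=; lra.
Qed.

Lemma holder_class_le j k a D f : (j <= k)%N -> holder_class k a D f -> holder_class j 0 D f.
Proof.
elim: j k f => [|j IH] [|k] f //= jk.
- by move=> [cf _]; split; last exact: locally_hoelder0.
- by move=> [cf _]; split; last exact: locally_hoelder0.
- move=> [cf df]; split=> // i; have [dfi hfi] := df i.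
  by split=> //; exact: IH hfi.
Qed.

Lemma local_defining_function_le j k a A p f : (j <= k)%N ->
  local_defining_function k a A p f -> local_defining_function j 0 A p f.
Proof.
by move=> jk [r r0 [hf gf Af bf]]; exists r => //; split=> //; exact: holder_class_le hf.
Qed.

Lemma holder_class_has_grad k a D f p : open D -> D p ->
  holder_class k.+1 a D f -> has_grad f p (grad f p).
Proof.
move=> oD Dp [_ df]; apply: C1_has_grad.
  have : nbhs p D by apply: open_nbhs_nbhs.
  by apply: filterS => q Dq i; have [+ _] := df i; apply.
by move=> i; have [_ /holder_class_continuous] := df i; apply.
Qed.

Lemma holder_class_has_jac k a D f p : open D -> D p ->
  holder_class k.+2 a D f -> has_jac (grad f) p (hess f p).
Proof.
move=> oD Dp [_ df]; apply: has_jac_rows => j; have [_ dfj] := df j.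
have := holder_class_has_grad oD Dp dfj.
have -> : (fun q => grad f q 0 j) = partial j f by apply/funext => q; rewrite mxE.
by congr has_grad; apply/rowP => i; rewrite !mxE.
Qed.

(** A field whose derivative along [v] is parallel to the field changes only in length. For [G] the
    gradient of a defining function and [v] tangent, this exhibits the principal curvature 0. *)
Lemma derive_normalize (G : V -> V) p v (J : 'M[R]_n) c : has_jac G p J -> G p != 0 ->
  v *m J = c *: G p -> 'D_v (fun q => - normalize (G q)) p = 0.
Proof.
move=> GJ Gp0 vJ.
have dG i : is_derive (0 : R) 1 (fun s : R => G (p + s *: v) 0 i) (c * G p 0 i).
  suff H : (fun h : R => h^-1 *: (((fun s : R => G (p + s *: v) 0 i) \o shift 0) (h *: (1 : R)) -
      G (p + 0 *: v) 0 i)) @ 0^' --> c * G p 0 i.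
    by apply: DeriveDef; [apply/cvg_ex; eexists; exact: H | apply: cvg_lim].
  have := has_jac_cvg (v := v) GJ; rewrite vJ => H.
  have -> : c * G p 0 i = (c *: G p) 0 i by rewrite mxE.
  have -> : (fun h : R => h^-1 *: (((fun s : R => G (p + s *: v) 0 i) \o shift 0) (h *: (1 : R)) -
      G (p + 0 *: v) 0 i)) = (fun M : V => M 0 i) \o (fun s : R => s^-1 *: (G (p + s *: v) - G p)).
    by apply/funext => h /=; rewrite !mxE scale0r !addr0 [h *: 1]mulr1.
  exact: (cvg_comp _ (fun M : V => M 0 i) H (@coord_continuous R 1 n 0 i _)).
pose N (s : R) := dotp (G (p + s *: v)) (G (p + s *: v)).
have N0 : 0 < N 0 by rewrite /N scale0r addr0 dotp_gt0.
have dN : is_derive (0 : R) 1 N (2 * c * N 0).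
  have -> : N = \sum_(i < n)
      ((fun s : R => G (p + s *: v) 0 i) * (fun s : R => G (p + s *: v) 0 i)).
    by apply/funext => s; rewrite fct_sumE.
  apply: (is_derive_eq (is_derive_sum (fun i => is_deriveM (dG i) (dG i)))).
  rewrite fct_sumE mulr_sumr; apply: eq_bigr => i _.
  by rewrite !fctE !scale0r !addr0 /GRing.scale/=; ring.
have dS := is_derive1_comp (is_derive1_sqrt N0) dN.
have S0 : Num.sqrt (N 0) != 0 by rewrite gt_eqF// sqrtr_gt0.
have dI := is_deriveV (f := Num.sqrt \o N) S0 dS.
have D j : is_derive p v (fun q => (- normalize (G q)) 0 j) 0.
  suff : is_derive (p + 0 *: v) v (fun q => (- normalize (G q)) 0 j) 0 by rewrite scale0r addr0.
  apply/is_derive_line.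
  have -> : (fun s : R => (- normalize (G (p + s *: v))) 0 j) =
      - ((fun s => ((Num.sqrt \o N) s)^-1) * (fun s : R => G (p + s *: v) 0 j)).
    by apply/funext => s; rewrite !mxE.
  apply: (is_derive_eq (is_deriveN (is_deriveM dI (dG j)))).
  rewrite !scale0r !addr0 /GRing.scale/=.
  have : N 0 = Num.sqrt (N 0) ^+ 2 by rewrite sqr_sqrtr// ltW.
  move: S0; set S := Num.sqrt (N 0) => S0 ->; field.
  by [].
rewrite derive_mx.
  by apply/rowP => j; rewrite !mxE derive_val.
by apply/derivable_mxP => i j; rewrite ord1; have [] := D j.
Qed.

End smooth_functions.

(** * Gauges of convex bodies *)

Section convex_body.
Context {R : realType} {n : nat} (K : set 'rV[R]_n).
Context (K_compact : compact K) (K_convex : convex_set K) (K_int0 : K° 0).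
Local Notation V := 'rV[R]_n.
Implicit Types (p q u v z d : V) (t c e : R).

Lemma body_conv t u v : 0 <= t <= 1 -> K u -> K v -> K ((1 - t) *: u + t *: v).
Proof.
move=> /andP[t0 t1] Ku Kv.
have := K_convex (Itv01 t0 t1) (mem_set Kv) (mem_set Ku).
by rewrite inE /= addrC.
Qed.

Lemma body0 : K 0.
Proof. exact: interior_subset K_int0. Qed.

Lemma body_scale t u : 0 <= t <= 1 -> K u -> K (t *: u).
Proof. by move=> t01 Ku; have := body_conv t01 body0 Ku; rewrite scaler0 add0r. Qed.

Lemma body_closed : closed K.
Proof. by apply: compact_closed => //; exact: norm_hausdorff. Qed.

Lemma body_limit u : (forall e, 0 < e -> exists2 z, K z & `|u - z| < e) -> K u.
Proof.
move=> H; apply: body_closed => A /nbhs_ballP[e /= e0]; rewrite -ball_normE => uA.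
by have [z Kz zu] := H _ e0; exists z; split=> //; exact: uA.
Qed.

Lemma body_bound : exists2 C, 0 < C & forall z, K z -> `|z| <= C.
Proof.
have /ex_strict_bound_gt0[C C0 KC] := compact_bounded K_compact.
by exists C => // z /KC/ltW.
Qed.

Lemma body_ball : exists2 r, 0 < r & forall z, `|z| < r -> K z.
Proof. exact: near0_ball K_int0. Qed.

Lemma body_dotp_gt0 p : p != 0 -> exists2 k, K k & 0 < dotp p k.
Proof.
move=> p0; have [r r0 Kr] := body_ball.
have pn : 0 < `|p| by rewrite normr_gt0.
exists ((r / 2 / `|p|) *: p); last by rewrite dotpZr mulr_gt0 ?dotp_gt0// !divr_gt0.
apply: Kr; rewrite normrZ ger0_norm ?divfK ?gt_eqF// ?ltr_pdivrMr//.
  by rewrite ltr_pMr// ltr1n.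
by rewrite !divr_ge0// ltW.
Qed.

Lemma gauge_lbound v : lbound [set t | 0 < t /\ [set t *: z | z in K] v] 0.
Proof. by move=> t [/ltW]. Qed.

Lemma gauge_has_inf v : has_inf [set t | 0 < t /\ [set t *: z | z in K] v].
Proof.
split; last by exists 0; exact: gauge_lbound.
have [r r0 Kr] := body_ball.
have v1 : 0 < `|v| + 1 by rewrite ltr_pwDr.
exists ((`|v| + 1) / r); split; first by rewrite divr_gt0.
exists (r / (`|v| + 1) *: v).
  apply: Kr; rewrite normrZ ger0_norm; last by rewrite divr_ge0// ltW.
  by rewrite mulrAC ltr_pdivrMr// ltr_pM2l// ltrDl.
by rewrite scalerA -[X in X * _]invf_div mulVf ?scale1r// gt_eqF// divr_gt0.
Qed.

Lemma gauge_ge0 v : 0 <= gauge K v.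
Proof. by apply: lb_le_inf; [have [] := gauge_has_inf v | exact: gauge_lbound]. Qed.

Lemma gauge_le t z : 0 < t -> K z -> gauge K (t *: z) <= t.
Proof.
move=> t0 Kz; apply: ge_inf; first by have [] := gauge_has_inf (t *: z).
by split=> //; exists z.
Qed.

Lemma gauge_lt_body t v : gauge K v < t -> K (t^-1 *: v).
Proof.
move=> vt; have e0 : 0 < t - gauge K v by rewrite subr_gt0.
have [s [s0 [z Kz <-]] st] := inf_adherent e0 (gauge_has_inf v).
rewrite -/(gauge K v) addrC subrK in st.
rewrite scalerA; apply: body_scale Kz.
by rewrite mulrC divr_ge0 ?ler_pdivrMr ?(lt_trans s0 st)// ?mul1r ?ltW// (lt_trans s0 st).
Qed.

Lemma gauge_le_body t v : 0 < t -> gauge K v <= t -> K (t^-1 *: v).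
Proof.
move=> t0 vt; apply: body_limit => e e0.
have v1 : 0 < `|v| + 1 by rewrite ltr_pwDr.
(* Chosen so that [(t + d)^-1 *: v], which lies in [K] by the strict case, is within [e] of
   [t^-1 *: v]: the distance is d |v| / (t (t + d)) < d (|v| + 1) / t^2. *)
pose d := e * t ^+ 2 / (`|v| + 1).
have d0 : 0 < d by rewrite divr_gt0// mulr_gt0// exprn_gt0.
have td : 0 < t + d by rewrite addr_gt0.
exists ((t + d)^-1 *: v); first by apply: gauge_lt_body; rewrite (le_lt_trans vt)// ltrDl.
rewrite -scalerBl normrZ.
have -> : t^-1 - (t + d)^-1 = d / (t * (t + d)).
  by field; rewrite !gt_eqF.
rewrite ger0_norm; last by rewrite divr_ge0 ?mulr_ge0 ?ltW.
rewrite mulrAC ltr_pdivrMr ?mulr_gt0//.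
apply: (@le_lt_trans _ _ (d * (`|v| + 1))); first by rewrite ler_wpM2l ?(ltW d0)// lerDl.
by rewrite /d divfK ?gt_eqF// ltr_pM2l// expr2 ltr_pM2l// ltrDl.
Qed.

Lemma gauge_gt0 v : v != 0 -> 0 < gauge K v.
Proof.
move=> v0; have [C C0 KC] := body_bound.
have vn : 0 < `|v| by rewrite normr_gt0.
rewrite ltNge; apply/negP => g0.
(* Dividing [v] by this number would give a point of [K] of norm 2 C, beyond the bound C. *)
have d0 : 0 < `|v| / (2 * C) by rewrite divr_gt0// mulr_gt0.
have /KC := gauge_le_body d0 (le_trans g0 (ltW d0)).
rewrite normrZ ger0_norm; last by rewrite invr_ge0 ltW.
rewrite invf_div divfK ?gt_eqF// => CC.
by move: C0; rewrite ltNge => /negP; apply; lra.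
Qed.

Lemma gauge_decomp v : exists2 z, K z & v = gauge K v *: z.
Proof.
have [->|v0] := eqVneq v 0; first by exists 0; [exact: body0 | rewrite scaler0].
exists ((gauge K v)^-1 *: v); first by apply: gauge_le_body => //; exact: gauge_gt0.
by rewrite scalerA divff ?scale1r// gt_eqF// gauge_gt0.
Qed.

Lemma gauge_leZ t z : 0 <= t -> K z -> gauge K (t *: z) <= t.
Proof.
rewrite le_eqVlt => /predU1P[<- Kz|t0 Kz]; last exact: gauge_le.
rewrite scale0r; apply/ler_addgt0Pr => e e0; rewrite add0r.
by have := gauge_le e0 body0; rewrite scaler0.
Qed.

Lemma gaugeZ c v : 0 <= c -> gauge K (c *: v) = c * gauge K v.
Proof.
rewrite le_eqVlt => /predU1P[<-|c0].
  rewrite scale0r mul0r; apply/eqP; rewrite eq_le gauge_ge0 andbT.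
  by have := gauge_leZ (lexx 0) body0; rewrite scale0r.
have le b w : 0 < b -> gauge K (b *: w) <= b * gauge K w.
  move=> b0; have [z Kz {1}->] := gauge_decomp w.
  by rewrite scalerA gauge_leZ// mulr_ge0 ?gauge_ge0// ltW.
apply/eqP; rewrite eq_le le//= mulrC -ler_pdivlMr//.
have := le c^-1 (c *: v); rewrite invr_gt0 => /(_ c0).
by rewrite scalerA mulVf ?gt_eqF// scale1r mulrC.
Qed.

Lemma gaugeD u v : gauge K (u + v) <= gauge K u + gauge K v.
Proof.
have [z Kz Ez] := gauge_decomp u; have [w Kw Ew] := gauge_decomp v.
have [u0|u0] := eqVneq u 0; first by rewrite {1}u0 add0r lerDr gauge_ge0.
have g0 : 0 < gauge K u + gauge K v by rewrite ltr_pwDl ?gauge_gt0 ?gauge_ge0.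
have -> : u + v = (gauge K u + gauge K v) *:
    ((1 - gauge K v / (gauge K u + gauge K v)) *: z +
     (gauge K v / (gauge K u + gauge K v)) *: w).
  rewrite {1}Ez {1}Ew scalerDr !scalerA; congr (_ *: _ + _ *: _); field; exact: lt0r_neq0.
apply: gauge_le => //; apply: body_conv => //.
by rewrite divr_ge0 ?gauge_ge0 ?(ltW g0)//= ler_pdivrMr// mul1r lerDr gauge_ge0.
Qed.

Definition argmax p : V := xget 0 [set z | K z /\ forall k, K k -> dotp p k <= dotp p z].

Lemma argmaxP p : K (argmax p) /\ forall k, K k -> dotp p k <= dotp p (argmax p).
Proof.
rewrite /argmax; case: xgetP => [z -> //|noz].
have [|c cK cmax] := @EVT_max_rV R n (dotp p) K (ex_intro _ 0 body0) K_compact.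
  by apply: continuous_subspaceT; exact: dotp_continuous.
exfalso; apply: (noz c); split; first by rewrite inE in cK.
by move=> k Kk; apply: cmax; rewrite inE.
Qed.

Lemma argmax_body p : K (argmax p). Proof. by have [] := argmaxP p. Qed.

Lemma polar_gaugeE p z : K z -> (forall k, K k -> dotp p k <= dotp p z) ->
  gauge (polar K) p = dotp p z.
Proof.
move=> Kz zmax.
have M0 : 0 <= dotp p z by rewrite -(dotp0r p) zmax//; exact: body0.
have E t : 0 < t -> dotp p z <= t -> [set t | 0 < t /\ [set t *: z | z in polar K] p] t.
  move=> t0 zt; split=> //; exists (t^-1 *: p); last by rewrite scalerA divff ?scale1r// gt_eqF.
  by move=> k Kk; rewrite dotpZl mulrC ler_pdivrMr// mul1r (le_trans (zmax _ Kk)).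
have L : lbound [set t | 0 < t /\ [set t *: z | z in polar K] p] (dotp p z).
  move=> t [t0 [w Kw <-]]; rewrite dotpZl -[leRHS]mulr1 ler_wpM2l ?(ltW t0)//; exact: Kw.
apply/eqP; rewrite eq_le; apply/andP; split; last first.
  apply: lb_le_inf => //; exists (dotp p z + 1).
  by apply: E; rewrite ?lerDl// ltr_pwDr.
(* The maximum may be 0, as for p = 0, while the set contains only positive numbers; hence the
   infimum is approached from above. *)
apply/ler_addgt0Pr => e e0; apply: ge_inf; first by exists (dotp p z).
by apply: E; rewrite ?lerDl ?(ltW e0)// ltr_wpDl.
Qed.

Lemma polar_gauge_argmax p : gauge (polar K) p = dotp p (argmax p).
Proof. by have [Kz zm] := argmaxP p; exact: polar_gaugeE. Qed.

Lemma dotp_le_polar_gauge p k : K k -> dotp p k <= gauge (polar K) p.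
Proof. by rewrite polar_gauge_argmax; have [_] := argmaxP p; apply. Qed.

Lemma dotp_le_gauges p v : dotp p v <= gauge (polar K) p * gauge K v.
Proof.
have [z Kz {1}->] := gauge_decomp v.
by rewrite dotpZr mulrC ler_wpM2r ?gauge_ge0// dotp_le_polar_gauge.
Qed.

Lemma polar_gauge_conv t p q : 0 <= t <= 1 ->
  gauge (polar K) ((1 - t) *: p + t *: q) <=
  (1 - t) * gauge (polar K) p + t * gauge (polar K) q.
Proof.
move=> /andP[t0 t1]; rewrite polar_gauge_argmax; set z := argmax _.
have Kz : K z by exact: argmax_body.
by rewrite dotpDl !dotpZl lerD// ler_wpM2l ?subr_ge0 ?dotp_le_polar_gauge.
Qed.

End convex_body.

(** * Normals and strict convexity of a smooth body *)

Section smooth_body.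
Context {R : realType} {n : nat} (K : set 'rV[R]_n).
Context (K_compact : compact K) (K_convex : convex_set K) (K_int0 : K° 0).
Local Notation V := 'rV[R]_n.
Implicit Types (p q u v z d g : V) (t c e : R) (f : V -> R).

Lemma has_grad_line f p g d e : has_grad f p g -> 0 < e ->
  exists2 r, 0 < r & forall s, 0 < s < r ->
    `|f (p + s *: d) - f p - s * dotp g d| <= s * e.
Proof.
move=> fg e0; have d1 : 0 < `|d| + 1 by rewrite ltr_pwDr.
have /near0_ball[r r0 H] := fg _ (divr_gt0 e0 d1).
exists (r / (`|d| + 1)); first by rewrite divr_gt0.
move=> s /andP[s0]; rewrite ltr_pdivlMr// => sr.
have : `|s *: d| < r.
  by rewrite normrZ gtr0_norm// (le_lt_trans _ sr)// ler_pM2l// lerDl.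
move=> /H; rewrite dotpZr => /le_trans; apply.
rewrite normrZ gtr0_norm// mulrCA ler_pM2l// mulrAC ler_pdivrMr//.
by rewrite ler_pM2l// lerDl.
Qed.

(** Farkas' lemma for one strict constraint: if the component [r] of [N] orthogonal to [g] were
    nonzero, the direction [t *: g - r] would violate the hypothesis for small t > 0. *)
Lemma halfspace_sub g (N : V) : g != 0 -> (forall d, 0 < dotp g d -> 0 <= dotp N d) ->
  exists2 c, 0 <= c & N = c *: g.
Proof.
move=> g0 H; have gg := dotp_gt0 g0.
have Ng : 0 <= dotp N g by exact: H.
pose c := dotp N g / dotp g g; pose r := N - c *: g.
have gr : dotp g r = 0.
  by rewrite dotpBr dotpZr (dotpC g N) /c divfK ?subrr// gt_eqF.
have Nr : dotp N r = dotp r r.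
  have := dotpBl N (c *: g) r; rewrite -/r dotpZl gr; lra.
exists c; first by rewrite divr_ge0// ltW.
apply/eqP; rewrite -subr_eq0 -/r; apply/eqP/dotp_eq0/eqP.
clearbody r.
rewrite eq_le dotp_ge0 andbT leNgt; apply/negP => r0.
(* This makes [t * dotp N g] at most half of [dotp r r]. *)
pose t := dotp r r / (2 * (dotp N g + 1)).
have N1 : 0 < 2 * (dotp N g + 1) by rewrite mulr_gt0// ltr_pwDr.
have t0 : 0 < t by rewrite divr_gt0.
have := H (t *: g - r); rewrite !dotpBr !dotpZr gr subr0 mulr_gt0// Nr => /(_ isT).
have : t * (2 * (dotp N g + 1)) = dotp r r by rewrite divfK// gt_eqF.
nra.
Qed.

Definition defines f q : Prop :=
  \forall w \near q, (K° w <-> 0 < f w) /\ (boundary K w <-> f w = 0).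

Lemma boundary_body p : boundary K p -> K p.
Proof. by move=> [+ _]; rewrite -((closure_id K).1 (body_closed K_compact)). Qed.

Lemma defines_body_ge0 f q : defines f q -> \forall w \near q, K w -> 0 <= f w.
Proof.
apply: filterS => w [iw bw] Kw; have [/iw/ltW//|nw] := pselect (K° w).
by rewrite (bw.1 _)//; split=> //; exact: subset_closure.
Qed.

(** Convexity keeps the segment from [p] to [k] in [K], where [f] is nonnegative near [p]; since [f]
    vanishes at [p], it cannot decrease to first order. *)
Lemma defines_grad_ge0 f p g k : boundary K p -> defines f p -> has_grad f p g -> K k ->
  0 <= dotp g (k - p).
Proof.
move=> bp fp fg Kk; rewrite leNgt; apply/negP => neg.
have fp0 : f p = 0 by have /nbhs_singleton[_ [+ _]] := fp; exact.
have /near_norm_addr/near0_ball[r2 r20 fge0] := defines_body_ge0 fp.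
have e0 : 0 < - dotp g (k - p) / 2 by rewrite divr_gt0// oppr_gt0.
have [r1 r10 H] := has_grad_line (k - p) fg e0.
pose r3 := r2 / (`|k - p| + 1).
have k1 : 0 < `|k - p| + 1 by rewrite ltr_pwDr.
have r30 : 0 < r3 by rewrite divr_gt0.
pose s := Num.min (Num.min r1 r3) 1 / 2.
have m0 : 0 < Num.min (Num.min r1 r3) 1 by rewrite !lt_min r10 r30 ltr01.
have s0 : 0 < s by rewrite divr_gt0.
have sm : s < Num.min (Num.min r1 r3) 1 by rewrite ltr_pdivrMr// ltr_pMr// ltr1n.
move: sm; rewrite !lt_min => /andP[/andP[s1 s3] s4].
have := H s; rewrite s0 s1 => /(_ isT).
have : 0 <= f (p + s *: (k - p)).
  apply: fge0.
    rewrite normrZ gtr0_norm//; move: s3; rewrite ltr_pdivlMr//; apply: le_lt_trans.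
    by rewrite ler_pM2l// lerDl.
  have -> : p + s *: (k - p) = (1 - s) *: p + s *: k.
    by rewrite scalerBr scalerBl scale1r addrA addrAC.
  by apply: body_conv => //; [rewrite !ltW | exact: boundary_body].
rewrite fp0 subr0 => f0; rewrite ler_norml => /andP[_].
nra.
Qed.

Lemma defines_inside f p g d : boundary K p -> defines f p -> has_grad f p g ->
  0 < dotp g d -> exists2 r, 0 < r & forall s, 0 < s < r -> K (p + s *: d).
Proof.
move=> bp fp fg gd.
have fp0 : f p = 0 by have /nbhs_singleton[_ [+ _]] := fp; exact.
have /near_norm_addr/near0_ball[r2 r20 fin] := fp.
have e0 : 0 < dotp g d / 2 by rewrite divr_gt0.
have [r1 r10 H] := has_grad_line d fg e0.
have k1 : 0 < `|d| + 1 by rewrite ltr_pwDr.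
have r30 : 0 < r2 / (`|d| + 1) by rewrite divr_gt0.
exists (Num.min r1 (r2 / (`|d| + 1))); first by rewrite lt_min r10.
move=> s /andP[s0]; rewrite lt_min => /andP[s1 s2].
apply: interior_subset; apply/(fin (s *: d) _).1.
  rewrite normrZ gtr0_norm//; move: s2; rewrite ltr_pdivlMr//; apply: le_lt_trans.
  by rewrite ler_pM2l// lerDl.
have := H s; rewrite s0 s1 => /(_ isT); rewrite fp0 subr0 ler_norml => /andP[+ _].
nra.
Qed.

(** Directions along which [f] increases enter [K], so [N] is nonnegative on them and
    [halfspace_sub] applies. *)
Lemma support_unique f p g (N : V) : boundary K p -> defines f p -> has_grad f p g ->
  g != 0 -> (forall k, K k -> 0 <= dotp N (k - p)) -> exists2 c, 0 <= c & N = c *: g.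
Proof.
move=> bp fp fg g0 HN; apply: halfspace_sub => // d gd.
have [r r0 Kr] := defines_inside bp fp fg gd.
have r2 : 0 < r / 2 < r by rewrite divr_gt0//= ltr_pdivrMr// ltr_pMr// ltr1n.
have := HN _ (Kr _ r2); rewrite addrAC subrr add0r dotpZr pmulr_rge0//.
by case/andP: r2.
Qed.

(** Strict because 0 is interior to [K]; this permits rescaling the normal so that it pairs to 1
    with the boundary point. *)
Lemma defines_dotp_lt0 f p g : boundary K p -> defines f p -> has_grad f p g ->
  g != 0 -> dotp g p < 0.
Proof.
move=> bp fp fg g0.
have ng0 : - g != 0 by rewrite oppr_eq0.
have [k Kk] := body_dotp_gt0 K_int0 ng0; rewrite dotpNl => gk.
have := defines_grad_ge0 bp fp fg Kk; rewrite dotpBr; lra.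
Qed.

Lemma max_boundary p z : p != 0 -> K z -> (forall k, K k -> dotp p k <= dotp p z) ->
  boundary K z.
Proof.
move=> p0 Kz zm; split; first exact: subset_closure.
move=> /near_norm_addr/near0_ball[r r0 Kr].
have pn : 0 < `|p| by rewrite normr_gt0.
have c0 : 0 < r / 2 / `|p| by rewrite !divr_gt0.
have : K (z + (r / 2 / `|p|) *: p).
  apply: Kr; rewrite normrZ gtr0_norm// divfK ?gt_eqF// ltr_pdivrMr//.
  by rewrite ltr_pMr// ltr1n.
move=> /zm; rewrite dotpDr dotpZr gerDl leNgt => /negP; apply.
by rewrite mulr_gt0// dotp_gt0.
Qed.

Lemma gauge1_boundary b : gauge K b = 1 -> boundary K b.
Proof.
move=> b1; have Kb : K b.
  by rewrite -[b]scale1r -invr1; apply: gauge_le_body => //; rewrite b1.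
have b0 : b != 0.
  apply/eqP => b0; move: b1; rewrite b0 -(scale0r 0) gaugeZ// mul0r => /eqP.
  by rewrite eq_sym oner_eq0.
split; first exact: subset_closure.
move=> /near_norm_addr/near0_ball[r r0 Kr].
have pn : 0 < `|b| by rewrite normr_gt0.
have c0 : 0 < r / 2 / `|b| by rewrite !divr_gt0.
have : K (b + (r / 2 / `|b|) *: b).
  apply: Kr; rewrite normrZ gtr0_norm// divfK ?gt_eqF// ltr_pdivrMr//.
  by rewrite ltr_pMr// ltr1n.
move=> /(gauge_le K_int0 ltr01); rewrite scale1r -{1}[b]scale1r -scalerDl gaugeZ//.
  by rewrite b1 mulr1 gerDl leNgt c0.
by rewrite addr_ge0// ltW.
Qed.

(** A defining function is regular by definition only at [p]; continuity of one nonvanishing partial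
    derivative spreads this, so that the same [f] describes the normals at all neighbouring boundary
    points. *)
Lemma local_defining_function_near f p : local_defining_function 2 0 K p f ->
  \forall q \near p, [/\ has_grad f q (grad f q), has_jac (grad f) q (hess f q),
    grad f q != 0 & defines f q].
Proof.
move=> [r r0 [hf gf Kf bf]].
have [i fi] : exists i, grad f p 0 i != 0.
  apply/existsP; apply: contraNT gf; rewrite negb_exists => /forallP H.
  by apply/eqP/rowP => i; rewrite [RHS]mxE; have := H i; rewrite negbK => /eqP.
have oB : open (ball p r) by exact: ball_open.
have nB : nbhs p (ball p r) by exact: nbhsx_ballx.
have ci : {for p, continuous (partial i f)}.
  by have [_ /(_ i)[_ [+ _]]] := hf; apply; exact: ballxx.
have ni : \forall q \near p, partial i f q != 0.
  apply: cvgr_neq0 ci _; by rewrite mxE in fi.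
near=> q.
have Bq : ball p r q by near: q.
split.
- exact: holder_class_has_grad hf.
- exact: holder_class_has_jac hf.
- apply/eqP => /rowP/(_ i); rewrite !mxE => /eqP.
  by apply/negP; near: q.
- have : nbhs q (ball p r) by apply: open_nbhs_nbhs.
  by apply: filterS => w Bw; split; [exact: Kf | exact: bf].
Unshelve. all: by end_near. Qed.

Context (K_smooth : forall p, boundary K p -> exists f, local_defining_function 2 0 K p f).

Lemma boundary_support b : boundary K b ->
  exists2 p, p != 0 & forall k, K k -> dotp p k <= dotp p b.
Proof.
move=> bb; have [f /local_defining_function_near/nbhs_singleton[fg _ g0 fd]] := K_smooth bb.
exists (- grad f b); first by rewrite oppr_eq0.
move=> k Kk; have := defines_grad_ge0 bb fd fg Kk.
by rewrite dotpBr !dotpNl lerN2 subr_ge0.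
Qed.

Context (K_curvature : forall p c, boundary K p -> is_principal_curvature K p c -> 0 < c).

(* Along a segment in the boundary the normal is constant, which produces the principal
   curvature 0. *)
Lemma max_unique p a b : p != 0 -> K a -> K b ->
  (forall k, K k -> dotp p k <= dotp p a) -> (forall k, K k -> dotp p k <= dotp p b) -> a = b.
Proof.
move=> p0 Ka Kb ma mb; apply/eqP; apply: contraT => ab.
pose v := b - a; pose q := a + 2^-1 *: v.
have v0 : v != 0 by rewrite subr_eq0 eq_sym.
have Kq s : `|s| <= 2^-1 -> K (q + s *: v).
  move=> s2; have -> : q + s *: v = (1 - (2^-1 + s)) *: a + (2^-1 + s) *: b.
    by rewrite /q -addrA -scalerDl scalerBr scalerBl scale1r addrA addrAC.
  by apply: body_conv => //; move: s2; rewrite ler_norml => /andP[]; lra.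
have pv : dotp p v = 0.
  by apply/eqP; rewrite dotpBr subr_eq0 eq_le ma// mb.
have mq s k : K k -> dotp p k <= dotp p (q + s *: v).
  by rewrite !dotpDr !dotpZr pv !mulr0 !addr0; exact: ma.
have bq s : `|s| <= 2^-1 -> boundary K (q + s *: v).
  by move=> s2; apply: (max_boundary p0); [exact: Kq | exact: mq].
have Bq : boundary K q by have := bq 0; rewrite scale0r addr0; apply; rewrite normr0.
have [f fq] := K_smooth Bq.
have /near_norm_addr/near0_ball[r r0 fr] := local_defining_function_near fq.
have fr0 := fr 0; rewrite normr0 addr0 in fr0; have [fg _ g0 fd] := fr0 r0.
(* [p] supports [K] all along the segment, so every inward normal there is a positive multiple of
   [- p]. *)
have const s : `|s| <= 2^-1 -> `|s *: v| < r ->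
    normalize (grad f (q + s *: v)) = normalize (- p).
  move=> s2 /fr[sg _ s0 sd].
  have [k Kk|c c0 pc] := support_unique (N := - p) (bq _ s2) sd sg s0.
    by rewrite dotpNl dotpBr oppr_ge0 subr_le0 mq.
  rewrite pc normalizeZ// lt_neqAle c0 andbT; apply: contra_neq p0 => c0'.
  by apply/eqP; rewrite -oppr_eq0 pc -c0' scale0r.
suff : is_principal_curvature K q 0 by move=> /(K_curvature Bq); rewrite ltxx.
exists f => //; exists v; split=> //.
  have [k Kk|c c0 pc] := support_unique (N := - p) Bq fd fg g0.
    by rewrite dotpNl dotpBr oppr_ge0 subr_le0; have := mq 0 k Kk; rewrite scale0r addr0.
  have c0' : c != 0 by apply: contra_neq p0 => c0'; apply/eqP; rewrite -oppr_eq0 pc c0' scale0r.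
  have : dotp (- p) v = 0 by rewrite dotpNl pv oppr0.
  by rewrite pc dotpZl => /eqP; rewrite mulf_eq0 (negbTE c0')/= dotpC => /eqP.
rewrite scale0r; apply: lim_near_cst => //=.
have v1 : 0 < `|v| + 1 by rewrite ltr_pwDr.
near=> s.
rewrite [s *: v + q]addrC const; first last.
- rewrite normrZ; apply: (@le_lt_trans _ _ (`|s| * (`|v| + 1))).
    by rewrite ler_wpM2l// lerDl.
  rewrite -ltr_pdivlMr//; near: s; apply: dnbhs0_lt; exact: divr_gt0.
- by near: s; apply: dnbhs0_le; rewrite invr_gt0.
have := const 0; rewrite scale0r addr0 !normr0 => ->//.
by rewrite subrr scaler0.
Unshelve. all: by end_near. Qed.

Lemma argmax_unique p z : p != 0 -> K z -> (forall k, K k -> dotp p k <= dotp p z) ->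
  argmax K p = z.
Proof.
move=> p0 Kz zm; have [Ka am] := argmaxP K_compact K_int0 p.
exact: max_unique p0 Ka Kz am zm.
Qed.

(** A functional that supports [K] at the normalized sum is maximal at both normalized summands as
    well, and [max_unique] identifies these. *)
Lemma gaugeD_eq u v : u != 0 -> v != 0 -> gauge K (u + v) = gauge K u + gauge K v ->
  (gauge K u)^-1 *: u = (gauge K v)^-1 *: v.
Proof.
move=> u0 v0 uv.
have gu := gauge_gt0 K_compact K_convex K_int0 u0.
have gv := gauge_gt0 K_compact K_convex K_int0 v0.
have guv : 0 < gauge K u + gauge K v by rewrite addr_gt0.
pose b := (gauge K u + gauge K v)^-1 *: (u + v).
have Bb : boundary K b.
  by apply: gauge1_boundary; rewrite /b gaugeZ// ?invr_ge0 ?ltW// uv mulVf// gt_eqF.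
have [p p0 pm] := boundary_support Bb.
have Ku : K ((gauge K u)^-1 *: u) by exact: gauge_le_body.
have Kv : K ((gauge K v)^-1 *: v) by exact: gauge_le_body.
have pb : dotp p u + dotp p v = (gauge K u + gauge K v) * dotp p b.
  by rewrite -dotpDr /b dotpZr mulrA divff ?mul1r// gt_eqF.
clearbody b; have pu := pm _ Ku; have pv := pm _ Kv.
rewrite !dotpZr ![_^-1 * _]mulrC !ler_pdivrMr// in pu pv.
apply: (max_unique p0) => // k Kk; rewrite dotpZr mulrC ler_pdivlMr//.
  have : dotp p k * gauge K u <= dotp p b * gauge K u by rewrite ler_pM2r ?pm.
  lra.
have : dotp p k * gauge K v <= dotp p b * gauge K v by rewrite ler_pM2r ?pm.
lra.
Qed.

End smooth_body.

(** * Differentiability of the inverse Gauss map *)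

Section gauss_map.
Context {R : realType} {n : nat} (K : set 'rV[R]_n).
Context (K_compact : compact K) (K_convex : convex_set K) (K_int0 : K° 0).
Context (K_smooth : forall p, boundary K p -> exists f, local_defining_function 2 0 K p f).
Context (K_curvature : forall p c, boundary K p -> is_principal_curvature K p c -> 0 < c).
Local Notation V := 'rV[R]_n.
Implicit Types (p q u v z d g a : V) (t c e : R) (f : V -> R).

Lemma mulmx_outer u a (b : V) : u *m (a^T *m b) = dotp u a *: b.
Proof.
rewrite mulmxA; apply/rowP => j; rewrite !mxE big_ord1 mxE; congr (_ * _).
by apply: eq_bigr => i _; rewrite mxE.
Qed.

Lemma has_jac_coord (F : V -> V) p (J : 'M[R]_n) j :
  has_jac F p J -> has_grad (fun q => F q 0 j) p (col j J)^T.
Proof.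
move=> FJ e e0; apply: filterS (FJ e e0) => d; apply: le_trans.
have -> : F (p + d) 0 j - F p 0 j - dotp (col j J)^T d = (F (p + d) - F p - d *m J) 0 j.
  by rewrite !mxE dotpC; congr (_ - _); apply: eq_bigr => i _; rewrite !mxE.
exact: ler_coord_norm.
Qed.

Lemma unitmx_inj (B : 'M[R]_n) : (forall u, u *m B = 0 -> u = 0) -> B \in unitmx.
Proof.
move=> inj; rewrite -row_free_unit -kermx_eq0; apply/eqP/row_matrixP => i.
by rewrite row0; apply: inj; apply/sub_kermxP; exact: row_sub.
Qed.

Lemma near_neq0 p : p != 0 -> \forall q \near p, q != 0.
Proof.
move=> p0; have pn : 0 < `|p| by rewrite normr_gt0.
apply: filterS (near_dist p pn) => q; apply: contraTneq => ->.
by rewrite subr0 ltxx.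
Qed.

(** Over the compact part of [K] outside a ball around the maximizer, [dotp p] stays below its
    maximum by a positive gap; a perturbation of [p] small against this gap cannot move the
    maximizer out of the ball. *)
Lemma argmax_near p e : p != 0 -> 0 < e ->
  \forall q \near p, `|argmax K q - argmax K p| < e.
Proof.
move=> p0 e0; set z0 := argmax K p.
pose S := K `&` ~` ball z0 e.
have cS : compact S.
  by apply: compact_closedI => //; apply: open_closedC; exact: ball_open.
have SE k : S k <-> K k /\ e <= `|k - z0|.
  by rewrite /S -ball_normE /setI /setC /= distrC leNgt; split=> -[? /negP].
have [S0|/set0P/negP/negPn/eqP S0] := pselect (S !=set0); last first.
  apply: filterS (near_dist p ltr01) => q _; rewrite ltNge; apply/negP => H.
  suff : set0 (argmax K q) by [].
  by rewrite -S0; apply/SE; split=> //; exact: argmax_body.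
have [|k1 k1S k1m] := @EVT_max_rV R n (dotp p) S S0 cS.
  by apply: continuous_subspaceT; exact: dotp_continuous.
move: k1S; rewrite inE => /SE[Kk1 k1e].
have [Kz0 z0m] := argmaxP K_compact K_int0 p.
have gap : 0 < dotp p z0 - dotp p k1.
  rewrite subr_gt0 lt_neqAle z0m// andbT; apply/eqP => E.
  have : z0 = k1.
    apply: (max_unique K_convex K_smooth K_curvature p0) => // k Kk.
    by rewrite E; exact: z0m.
  by move=> Ek; move: k1e; rewrite -Ek subrr normr0 leNgt e0.
have [C C0 KC] := body_bound K_compact.
(* [2 * C] bounds the diameter of [K]; the factor n comes from estimating [dotp] by sup norms. *)
have nC : 0 < n%:R * (2 * C) + 1 by rewrite ltr_pwDr// mulr_ge0// mulr_ge0// ltW.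
apply: filterS (near_dist p (divr_gt0 gap nC)) => q qp.
rewrite ltNge; apply/negP => H.
have [Kz zm] := argmaxP K_compact K_int0 q.
have zk1 : dotp p (argmax K q) <= dotp p k1 by apply: k1m; rewrite inE; apply/SE.
have : dotp (q - p) (argmax K q - z0) <= n%:R * `|q - p| * `|argmax K q - z0|.
  by rewrite (le_trans (ler_norm _))// norm_dotp_le.
have : `|argmax K q - z0| <= 2 * C.
  by rewrite (le_trans (ler_normB _ _))// mulr_natl mulr2n lerD// KC.
have := zm _ Kz0.
rewrite distrC ltr_pdivlMr// in qp.
rewrite !dotpBl !dotpBr => H1 H2 H3.
have : n%:R * `|q - p| * `|argmax K q - z0| <= n%:R * `|q - p| * (2 * C).
  by rewrite ler_wpM2l// mulr_ge0.
have : 0 <= `|q - p| by [].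
move: gap; move: H1 H3 zk1 qp; nra.
Qed.

(** Maximality at [p] and at [p + d] traps the remainder between 0 and [dotp d (z' - z)], with [z]
    and [z'] the two maximizers; continuity of [argmax] makes this small. *)
Lemma polar_gauge_has_grad p : p != 0 -> has_grad (gauge (polar K)) p (argmax K p).
Proof.
move=> p0 e e0; have n0 : 0 < e / n.+1%:R by rewrite divr_gt0.
have /near_norm_addr := argmax_near p0 n0; apply: filterS => d H.
rewrite !(polar_gauge_argmax K_compact K_int0).
have [Kz zm] := argmaxP K_compact K_int0 p.
have [Kz' z'm] := argmaxP K_compact K_int0 (p + d).
move: H z'm zm Kz' Kz; set z' := argmax K (p + d); set z := argmax K p => H z'm zm Kz' Kz.
have h1 := z'm _ Kz; have h2 := zm _ Kz'.
rewrite !dotpDl in h1; rewrite dotpDl (dotpC z d).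
rewrite ger0_norm; last lra.
apply: (@le_trans _ _ (dotp d (z' - z))); first by rewrite dotpBr; lra.
rewrite (le_trans (ler_norm _))// (le_trans (norm_dotp_le _ _))//.
apply: (@le_trans _ _ (n%:R * `|d| * (e / n.+1%:R))).
  by rewrite ler_wpM2l ?mulr_ge0// ltW.
rewrite mulrAC ler_wpM2r// mulrCA ler_piMr ?(ltW e0)//.
by rewrite ler_pdivrMr// mul1r ler_nat.
Qed.

Lemma hess_polar_gauge p (J : 'M[R]_n) : p != 0 -> has_jac (argmax K) p J ->
  hess (gauge (polar K)) p = J.
Proof.
move=> p0 pJ; apply/matrixP => i j; rewrite mxE {1}/partial.
rewrite (@near_eq_derive _ _ _ _ (fun q => argmax K q 0 j)).
  by rewrite (has_grad_derive _ (has_jac_coord j pJ)) dotp_delta !mxE.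
apply: filterS (near_neq0 p0) => q q0.
by rewrite /partial (has_grad_derive _ (polar_gauge_has_grad q0)) dotp_delta.
Qed.

Section boundary_point.
Context (z0 : V) (f : V -> R) (bz0 : boundary K z0) (fK : local_defining_function 2 0 K z0 f).
Let g0 := grad f z0.
Let k0 := dotp g0 z0.
Let m := k0^-1 *: g0.
Let D := hess f z0.
(** The factor [1%:M - z0^T *m m] is the projection along [m] onto the vectors orthogonal to [z0].
    It discards the component that a rescaling of the normal can change. *)
Let L : 'M[R]_n := D *m (1%:M - z0^T *m m) + m^T *m m.

Lemma defining_function_at : [/\ has_grad f z0 g0, has_jac (grad f) z0 D, g0 != 0 & defines K f z0].
Proof. exact: nbhs_singleton (local_defining_function_near fK). Qed.

Lemma dotp_grad_lt0 : k0 < 0.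
Proof. have [fg _ gn fd] := defining_function_at; exact: defines_dotp_lt0 bz0 fd fg gn. Qed.

Lemma conormal_dotp : dotp m z0 = 1.
Proof. by rewrite dotpZl mulVf// lt_eqF// dotp_grad_lt0. Qed.

Lemma conormal_neq0 : m != 0.
Proof. exact: dotp1_neq0 conormal_dotp. Qed.

Lemma conormal_max k : K k -> dotp m k <= dotp m z0.
Proof.
have [fg _ gn fd] := defining_function_at => Kk.
have := defines_grad_ge0 K_compact K_convex bz0 fd fg Kk.
rewrite !dotpZl => H; have := dotp_grad_lt0; rewrite -invr_lt0 => k0n.
by rewrite ler_nM2l// -subr_ge0 -dotpBr.
Qed.

Lemma argmax_conormal : argmax K m = z0.
Proof.
by apply: argmax_unique => //; [exact: conormal_neq0 | exact: boundary_body | exact: conormal_max].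
Qed.

Lemma conormal_unique (N : V) : (forall k, K k -> 0 <= dotp N (z0 - k)) -> dotp N z0 = 1 -> N = m.
Proof.
have [fg _ gn fd] := defining_function_at => NK N1.
have [k Kk|c _ E] := support_unique (N := - N) bz0 fd fg gn.
  by rewrite dotpNl -dotpNr opprB NK.
have E' : N = (- c) *: g0 by rewrite scaleNr -E opprK.
move: N1; rewrite E' dotpZl -/k0 => ck.
rewrite /m; congr (_ *: _); apply: (mulIf (ltr0_neq0 dotp_grad_lt0)).
by rewrite ck mulVf// ltr0_neq0// dotp_grad_lt0.
Qed.

Lemma bordered_mul d : d *m L = d *m D - dotp (d *m D) z0 *: m + dotp d m *: m.
Proof. by rewrite mulmxDr mulmxA mulmxBr mulmx1 !mulmx_outer. Qed.

(** Pairing [d *m L = 0] with [z0] shows that [d] is tangent; then [d *m D] is parallel to the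
    normal, so [d] would be a direction of principal curvature 0. *)
Lemma bordered_unit : L \in unitmx.
Proof.
apply: unitmx_inj => d dL.
have dm : dotp d m = 0.
  have := congr1 (fun u => dotp u z0) dL.
  by rewrite bordered_mul dotpDl dotpBl !(dotpZl _ m) conormal_dotp !mulr1 subrr add0r dotp0l.
have dD : d *m D = (dotp (d *m D) z0 / k0) *: g0.
  move: dL; rewrite bordered_mul dm scale0r addr0 => /eqP.
  by rewrite subr_eq0 => /eqP {1}->; rewrite /m scalerA.
apply/eqP; apply: contraT => d0.
have [fg fj gn fd] := defining_function_at.
suff : is_principal_curvature K z0 0 by move=> /(K_curvature bz0); rewrite ltxx.
exists f => //; exists d; split=> //; last by rewrite scale0r (derive_normalize fj gn dD).
move: dm; rewrite dotpZr => /eqP; rewrite mulf_eq0 invr_eq0.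
by rewrite (negbTE (ltr0_neq0 dotp_grad_lt0))/= => /eqP.
Qed.

(* The normal to K at argmax (m + a) is parallel to m + a; linearizing this relation at z0
   and eliminating the factor of proportionality by pairing with z0 determines d = argmax
   (m + a) - z0 up to o(d).  The term m^T *m m of L accounts for d being tangent to first
   order. *)
Lemma argmax_increment e : 0 < e -> \forall a \near (0 : V),
  `|k0 *: (a - dotp a z0 *: m) - (argmax K (m + a) - z0) *m L| <=
    e * `|argmax K (m + a) - z0|.
Proof.
move=> e0; have [fg fj gn fd] := defining_function_at.
have [CD CD0 HD] := norm_mulmx_le D.
(* [B] collects the bounds for [r], [dotp r z0 *: m] and [dotp d m *: m]; [B2] collects those for
   the two products that are small with [a]. *)
pose B := 1 + n%:R * `|z0| * `|m| + `|k0|^-1 * `|m|.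
have B0 : 0 < B by rewrite /B -addrA ltr_pwDl// addr_ge0// ?mulr_ge0// ?invr_ge0.
pose e1 := Num.min 1 (e / 2 / B).
have e10 : 0 < e1 by rewrite lt_min ltr01 !divr_gt0.
pose B2 := 2 * n%:R * `|z0| * (CD + 1) + 1.
have B20 : 0 < B2.
  by rewrite /B2 ltr_pwDr// mulr_ge0 ?addr_ge0 ?(ltW CD0)// !mulr_ge0.
have B3 : 0 < e / 2 / B2 by rewrite !divr_gt0.
have /near_norm_addr/near0_ball[r1 r10 H1] := local_defining_function_near fK.
have /near0_ball[r2 r20 H2] := fj _ e10.
have /near0_ball[r3 r30 H3] := fg _ e10.
have r0 : 0 < Num.min r1 (Num.min r2 r3) by rewrite !lt_min r10 r20.
have /near_norm_addr Hz := argmax_near conormal_neq0 r0.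
have /near_norm_addr Hn := near_neq0 conormal_neq0.
near=> a; set d := argmax K (m + a) - z0.
have p0 : m + a != 0 by near: a.
have [Kz zm] := argmaxP K_compact K_int0 (m + a).
have zE : argmax K (m + a) = z0 + d by rewrite /d [RHS]addrC subrK.
have : `|argmax K (m + a) - argmax K m| < Num.min r1 (Num.min r2 r3) by near: a.
rewrite argmax_conormal -/d !lt_min => /and3P[d1 d2 d3].
have a1 : `|a| < e / 2 / B2 by near: a; exact: near0_norm.
have bz := max_boundary p0 Kz zm.
have [zg _ zn zd] := H1 _ d1; rewrite -zE in zg zn zd.
have [k Kk|c c0 pc] := support_unique (N := - (m + a)) bz zd zg zn.
  by rewrite dotpNl dotpBr oppr_ge0 subr_le0 zm.
have cn : c != 0.
  by apply: contra_neq p0 => c0'; apply/eqP; rewrite -oppr_eq0 pc c0' scale0r.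
pose s := - c^-1.
have sp : grad f (argmax K (m + a)) = s *: (m + a).
  by rewrite /s scaleNr -scalerN pc scalerA mulVf// scale1r.
have := H2 _ d2; rewrite -zE sp.
pose r := s *: (m + a) - g0 - d *m D; rewrite -/g0 -/r => rd.
pose u := d *m D + r; pose al := dotp a z0.
have spE : s *: (m + a) = k0 *: m + u.
  have -> : k0 *: m = g0 by rewrite /m scalerA divff ?scale1r// ltr0_neq0// dotp_grad_lt0.
  by rewrite /u /r [_ + (_ - _)]addrC subrK [RHS]addrC subrK.
have sE : s * (1 + al) = k0 + dotp u z0.
  have := congr1 (fun w => dotp w z0) spE.
  by rewrite dotpZl !dotpDl (dotpZl k0 m) conormal_dotp mulr1.
(* The unknown factor [s] is eliminated exactly, before any estimate is made. *)
have key : (1 + al) *: u - dotp u z0 *: (m + a) = k0 *: (a - al *: m).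
  have -> : dotp u z0 *: (m + a) = (s * (1 + al)) *: (m + a) - k0 *: (m + a).
    by rewrite sE scalerDl addrAC subrr add0r.
  rewrite mulrC -scalerA spE !scalerDr !scalerDl !scale1r !scalerN.
  apply/rowP => i; rewrite !mxE; ring.
have -> : k0 *: (a - dotp a z0 *: m) - d *m L =
    r - dotp r z0 *: m - dotp d m *: m + (al *: u - dotp u z0 *: a).
  rewrite -/al -key bordered_mul /u !dotpDl; apply/rowP => i; rewrite !mxE; ring.
have du : `|u| <= (CD + 1) * `|d|.
  rewrite /u (le_trans (ler_normD _ _))// mulrDl lerD//.
  by rewrite (le_trans rd)// ler_wpM2r// ge_min lexx.
(* [f] vanishes at both boundary points, so its first-order expansion at [z0] bounds [dotp g0 d]. *)
have dm : `|dotp d m| <= `|k0|^-1 * (e1 * `|d|).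
  rewrite dotpZr normrM normfV ler_wpM2l ?invr_ge0//.
  have := H3 _ d3; rewrite -zE.
  have -> : f (argmax K (m + a)) = 0 by have /nbhs_singleton[_ [+ _]] := zd; exact.
  have -> : f z0 = 0 by have /nbhs_singleton[_ [+ _]] := fd; exact.
  by rewrite subrr add0r normrN dotpC.
have t1 : `|r - dotp r z0 *: m - dotp d m *: m| <= e / 2 * `|d|.
  apply: (@le_trans _ _ (B * (e1 * `|d|))); last first.
    rewrite mulrA ler_wpM2r// mulrC -ler_pdivlMr//.
    by rewrite ge_min lexx orbT.
  rewrite /B !mulrDl mul1r.
  rewrite (le_trans (ler_normB _ _))// lerD//; last first.
    by rewrite normrZ mulrAC ler_wpM2r.
  rewrite (le_trans (ler_normB _ _))// lerD//.
  rewrite normrZ mulrAC ler_wpM2r// (le_trans (norm_dotp_le _ _))//.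
  by rewrite -!mulrA ler_wpM2l// mulrC ler_wpM2l.
have t2 : `|al *: u - dotp u z0 *: a| <= e / 2 * `|d|.
  have aB : B2 * `|a| <= e / 2 by rewrite mulrC -ler_pdivlMr// ltW.
  rewrite (le_trans (ler_normB _ _))// !normrZ.
  have h1 : `|al| * `|u| <= n%:R * `|a| * `|z0| * ((CD + 1) * `|d|).
    by apply: ler_pM => //; exact: norm_dotp_le.
  have h2 : `|dotp u z0| * `|a| <= n%:R * ((CD + 1) * `|d|) * `|z0| * `|a|.
    rewrite ler_wpM2r// (le_trans (norm_dotp_le _ _))// ler_wpM2r// ler_wpM2l//.
  have : B2 * `|a| * `|d| <= e / 2 * `|d| by rewrite ler_wpM2r.
  have : 0 <= `|a| * `|d| by rewrite mulr_ge0.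
  move: h1 h2; rewrite /B2; lra.
rewrite (le_trans (ler_normD _ _))//; move: t1 t2; lra.
Unshelve. all: by end_near. Qed.

(** Inverting [L] in [argmax_increment] leaves an error relative to the increment of [argmax], not
    to [a]; it is absorbed after showing that this increment is O(a). *)
Lemma argmax_has_jac : has_jac (argmax K) m (k0 *: ((1%:M - z0^T *m m) *m invmx L)).
Proof.
set J := k0 *: _; move=> e e0.
have [CB CB0 HB] := norm_mulmx_le (invmx L).
have [CJ CJ0 HJ] := norm_mulmx_le J.
(* The first bound gives |d| <= 2 CJ |a| by absorption; the second then turns the error into e
   |a|. *)
pose e2 := Num.min (2^-1 / CB) (e / (2 * CB * CJ)).
have e20 : 0 < e2 by rewrite lt_min !divr_gt0 ?mulr_gt0.
have := argmax_increment e20; apply: filterS => a.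
rewrite argmax_conormal; set d := argmax K (m + a) - z0; set E := _ - d *m L => HE.
have dE : d - a *m J = - (E *m invmx L).
  rewrite /E mulmxBl -mulmxA mulmxV ?bordered_unit// mulmx1 opprB; congr (_ - _).
  rewrite /J -scalemxAr -scalemxAl; congr (_ *: _).
  by rewrite mulmxA mulmxBr mulmx1 mulmx_outer.
have h1 : `|d - a *m J| <= CB * (e2 * `|d|).
  by rewrite dE normrN (le_trans (HB _))// ler_wpM2l// ltW.
have c1 : CB * e2 <= 2^-1.
  by rewrite mulrC -ler_pdivlMr// ge_min lexx.
have h2 : `|d| <= 2 * (CJ * `|a|).
  have : `|d| <= `|d - a *m J| + `|a *m J|.
    by rewrite -[X in `|X| <= _](subrK (a *m J)) ler_normD.
  have := HJ a; have : CB * e2 * `|d| <= 2^-1 * `|d| by rewrite ler_wpM2r.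
  move: h1; lra.
apply: (le_trans h1); rewrite mulrA.
apply: (@le_trans _ _ (CB * e2 * (2 * (CJ * `|a|)))).
  by rewrite ler_wpM2l// mulr_ge0// ltW.
rewrite !mulrA ler_wpM2r//.
have -> : CB * e2 * 2 * CJ = e2 * (2 * CB * CJ) by ring.
by rewrite -ler_pdivlMr ?mulr_gt0// ge_min lexx orbT.
Qed.

End boundary_point.

(** Hides the defining function. The last two clauses, uniqueness of the conormal and the inward
    directions, later stand in for the gradient of [gauge K]. *)
Lemma gauss_map z0 : boundary K z0 -> exists m (J : 'M[R]_n),
  [/\ argmax K m = z0, dotp m z0 = 1, has_jac (argmax K) m J,
    forall N : V, (forall k, K k -> 0 <= dotp N (z0 - k)) -> dotp N z0 = 1 -> N = m &
    forall d, dotp m d < 0 -> exists2 r, 0 < r & forall s, 0 < s < r -> K (z0 + s *: d)].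
Proof.
move=> bz; have [f fK] := K_smooth bz.
exists ((dotp (grad f z0) z0)^-1 *: grad f z0); eexists; split.
- exact: argmax_conormal fK.
- exact: conormal_dotp fK.
- exact: argmax_has_jac fK.
- exact: conormal_unique fK.
- have [fg _ gn fd] := defining_function_at fK.
  move=> d; rewrite dotpZl nmulr_rlt0 ?invr_lt0 ?(dotp_grad_lt0 bz fK)// => gd.
  exact: (defines_inside bz fd fg gd).
Qed.

End gauss_map.

(** * Positivity of a determinant from bounds on real eigenvalues *)

Section determinant.
Context {R : realType} {n : nat}.

(** The determinant of [1%:M - s *: M] is a polynomial in s with value 1 at 0. A nonpositive value
    at T would give a root s in ]0, T], hence the eigenvalue 1 / s with T / s >= 1. *)
Lemma det_sub_scale_gt0 (M : 'M[R]_n) (T : R) : 0 < T ->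
  (forall c, eigenvalue M c -> c * T < 1) -> 0 < \det (1%:M - T *: M).
Proof.
move=> T0 MT.
pose P : {poly R} := \det (1%:M - 'X *: map_mx polyC M).
have PE s : P.[s] = \det (1%:M - s *: M).
  rewrite -[P.[s]]/(horner_eval s P) /P -det_map_mx; congr (\det _).
  apply/matrixP => i j; rewrite !mxE /= /horner_eval hornerD hornerN hornerM hornerX.
  by rewrite hornerC -polyC_natr hornerC.
rewrite -PE ltNge; apply/negP => PT.
have [|s] := @poly_ivt R (- P) 0 T (ltW T0).
  rewrite !hornerN oppr_ge0 PT andbT oppr_le0 PE scale0r subr0 det1; exact: ler01.
rewrite rootN => /andP[s0 sT] /rootP; rewrite PE => /eqP/det0P[v v0 vM].
have sn : s != 0.
  apply: contra_neq v0 => s0'; move: vM.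
  by rewrite s0' scale0r subr0 mulmx1.
have sp : 0 < s by rewrite lt_neqAle eq_sym sn.
have : eigenvalue M s^-1.
  apply/eigenvalueP; exists v => //; move: vM.
  rewrite mulmxBr mulmx1 -scalemxAr => /eqP; rewrite subr_eq0 => /eqP {2}->.
  by rewrite scalerA mulVf// scale1r.
by move=> /MT; rewrite mulrC ltr_pdivrMr// mul1r ltNge sT.
Qed.

End determinant.

(** * The Hessian of the polar gauge as a quadratic form *)

Section gauge_second_order.
Context {R : realType} {n : nat} (K : set 'rV[R]_n).
Context (K_compact : compact K) (K_convex : convex_set K) (K_int0 : K° 0).
Context (K_smooth : forall p, boundary K p -> exists f, local_defining_function 2 0 K p f).
Context (K_curvature : forall p c, boundary K p -> is_principal_curvature K p c -> 0 < c).
Local Notation V := 'rV[R]_n.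
Implicit Types (p q u v z d g a b : V) (t c e : R) (f : V -> R).
Context (m : V) (J : 'M[R]_n) (m0 : m != 0) (mJ : has_jac (argmax K) m J).
Let h := gauge (polar K).

Lemma cvg_ge0 (F : R -> R) (l : R) : (forall s, s != 0 -> 0 <= F s) ->
  F s @[s --> (0 : R)^'] --> l -> 0 <= l.
Proof.
move=> F0 Fl; rewrite leNgt; apply/negP => l0.
have nF : \forall s \near (0 : R)^', F s < 0 by exact: (cvgr_lt _ Fl).
near (0 : R)^' => s.
have : F s < 0 by near: s.
by rewrite ltNge F0//; near: s; exact: nbhs_dnbhs_neq.
Unshelve. all: by end_near. Qed.

Lemma polar_gauge_cvg a :
  (h (m + s *: a) - h m - s * dotp (argmax K m) a) / s ^+ 2 @[s --> (0 : R)^'] -->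
    2^-1 * dotp (a *m J) a.
Proof.
apply: (@taylor2_cvg _ _ h (argmax K) m J (fun=> a)) => //; last exact: cvg_cst.
apply: filterS (near_neq0 m0) => q q0 d.
by apply: has_grad_is_derive; exact: polar_gauge_has_grad.
Qed.

Lemma argmax_cvg a :
  s^-1 *: (argmax K (m + s *: a) - argmax K m) @[s --> (0 : R)^'] --> a *m J.
Proof. exact: has_jac_cvg. Qed.

(* This second-order form of the subgradient inequality at m + s a replaces the symmetry of
   the Hessian J of the polar gauge. *)
Lemma quad_subgrad a b :
  dotp (a *m J) a + 2 * dotp (a *m J) b <= dotp ((a + b) *m J) (a + b).
Proof.
suff : 0 <= 2^-1 * dotp ((a + b) *m J) (a + b) - 2^-1 * dotp (a *m J) a - dotp (a *m J) b.
  by lra.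
have cb : dotp (s^-1 *: (argmax K (m + s *: a) - argmax K m)) b @[s --> (0 : R)^'] -->
    dotp (a *m J) b.
  by apply: cvg_dotp; [exact: argmax_cvg | exact: cvg_cst].
have cv := cvgB (cvgB (@polar_gauge_cvg (a + b)) (@polar_gauge_cvg a)) cb.
refine (cvg_ge0 _ (cv _ _)) => s s0; rewrite !fctE.
have [Kz zm] := argmaxP K_compact K_int0 (m + s *: (a + b)).
have := zm _ (argmax_body K_compact K_int0 (m + s *: a)).
rewrite -(polar_gauge_argmax K_compact K_int0) -/h.
set z := argmax K (m + s *: a) => H.
have -> : (h (m + s *: (a + b)) - h m - s * dotp (argmax K m) (a + b)) / s ^+ 2 -
    (h (m + s *: a) - h m - s * dotp (argmax K m) a) / s ^+ 2 -
    dotp (s^-1 *: (z - argmax K m)) b =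
    (h (m + s *: (a + b)) - h (m + s *: a) - s * dotp z b) / s ^+ 2.
  by rewrite dotpZl dotpBl !dotpDr; field.
rewrite divr_ge0 ?sqr_ge0//.
have hz : h (m + s *: a) = dotp (m + s *: a) z by exact: polar_gauge_argmax.
have : dotp (m + s *: (a + b)) z = dotp (m + s *: a) z + s * dotp z b.
  by rewrite scalerDr addrA (dotpDl (m + s *: a) (s *: b)) (dotpZl s b) (dotpC b).
move: H hz; lra.
Qed.

Lemma quad_ge0 b : 0 <= dotp (b *m J) b.
Proof. by have := quad_subgrad 0 b; rewrite mul0mx !dotp0l mulr0 !add0r. Qed.

(** Tested at t = A / (B + 1), where the added 1 covers B = 0. *)
Lemma linear_le_square (A B : R) : 0 <= B -> (forall t, t * A <= t ^+ 2 * B) -> A = 0.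
Proof.
move=> B0 H; have := H (A / (B + 1)).
have B1 : 0 < B + 1 by rewrite ltr_wpDl.
have -> : A / (B + 1) * A = A ^+ 2 * (B + 1) / (B + 1) ^+ 2 by field; rewrite gt_eqF.
have -> : (A / (B + 1)) ^+ 2 * B = A ^+ 2 * B / (B + 1) ^+ 2 by field; rewrite gt_eqF.
rewrite ler_pM2r ?invr_gt0 ?exprn_gt0// mulrDr mulr1 gerDl => A0.
by apply/eqP; rewrite -sqrf_eq0 eq_le A0 sqr_ge0.
Qed.

(** The Cauchy-Schwarz argument for a semidefinite form, run twice because [dotp (a *m J) v] and
    [dotp (v *m J) a] are not known to agree: the first run kills the former for all [a], the second
    takes [v *m J] itself as test vector. *)
Lemma quad_eq0 v : dotp (v *m J) v = 0 -> v *m J = 0.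
Proof.
move=> v0.
have H1 a : dotp (a *m J) v = 0.
  suff : 2 * dotp (a *m J) v = 0 by move/eqP; rewrite mulf_eq0 pnatr_eq0/= => /eqP.
  apply: (@linear_le_square _ (dotp (a *m J) a)) => [|t]; first exact: quad_ge0.
  have := quad_subgrad (t *: a) (v - t *: a).
  have -> : t *: a + (v - t *: a) = v by rewrite addrC subrK.
  rewrite v0 -!scalemxAl !dotpZl dotpBr !dotpZr; lra.
apply: dotp_eq0; set b := v *m J.
apply: (@linear_le_square _ (dotp (b *m J) b)) => [|t]; first exact: quad_ge0.
have := quad_subgrad v (t *: b).
rewrite v0 mulmxDl !dotpDl !dotpDr v0 -!scalemxAl !dotpZl !dotpZr H1.
rewrite -/b; lra.
Qed.

End gauge_second_order.

(** * The obstacle along the segment to a closest point *)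

(** Everything cancels except (r1 - r2) / s^2. In the application r1 and r2 are values of [rho] on
    the path and at its base point, and eta is the polar gauge at m - s v. *)
Lemma second_order_quotient_ge0 {R : realType} (s c eta vz0 vz mz r1 r2 mD vD : R) :
  s != 0 -> s * mD = c * (1 - mz) -> s * vD = c * (vz0 - vz) -> r2 <= r1 ->
  eta = mz + s * - vz ->
  0 <= (r1 - r2 - s * mD) / s ^+ 2 + vD - c * ((eta - 1 - s * - vz0) / s ^+ 2).
Proof.
move=> s0 EmD EvD r12 Eeta.
have -> : (r1 - r2 - s * mD) / s ^+ 2 + vD - c * ((eta - 1 - s * - vz0) / s ^+ 2) =
   (r1 - r2 - s * mD + s * (s * vD) - c * (eta - 1 + s * vz0)) / s ^+ 2 by field.
by rewrite divr_ge0 ?sqr_ge0// EmD EvD Eeta; lra.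
Qed.

Section obstacle.
Context {R : realType} {n : nat} (K U : set 'rV[R]_n) (phi : 'rV[R]_n -> R).
Context (K_compact : compact K) (K_convex : convex_set K) (K_int0 : K° 0).
Context (K_smooth : forall p, boundary K p -> exists f, local_defining_function 2 0 K p f).
Context (K_curvature : forall p c, boundary K p -> is_principal_curvature K p c -> 0 < c).
Context (U_open : open U).
Context (phi_has_grad : forall p, has_grad phi p (grad phi p)).
Context (phi_grad : forall p, gauge (polar K) (grad phi p) < 1).
Local Notation V := 'rV[R]_n.
Local Notation gK := (gauge K).
Local Notation h := (gauge (polar K)).
Implicit Types (p q u v w z d g a b : V) (t c e s : R) (f : V -> R).

Lemma add_scale_conv p q k c s :
  p + c *: q - ((c - s) *: q + s *: k) = p + s *: (q - k).
Proof. by apply/rowP => i; rewrite !mxE; ring. Qed.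

Lemma scale_shift p q c s t :
  c *: p + s *: q = (c + s * t) *: p + s *: (q - t *: p).
Proof. by apply/rowP => i; rewrite !mxE; ring. Qed.

(** The mean value theorem turns the bound on [grad phi] into a strict Lipschitz bound with respect
    to [gauge K]. *)
Lemma obstacle_lt p q : p != q -> phi p - phi q < gK (p - q).
Proof.
move=> pq; pose v := p - q.
have dphi t : 0 <= t <= 1 -> is_derive (q + t *: v) v phi (dotp (grad phi (q + t *: v)) v).
  by move=> _; apply: has_grad_is_derive; exact: phi_has_grad.
have [t _] := MVT_line dphi; have -> : q + v = p by rewrite /v addrC subrK.
move=> ->.
rewrite (le_lt_trans (dotp_le_gauges K_compact K_convex K_int0 _ _))//.
have v0 : v != 0 by rewrite subr_eq0.
have gv := gauge_gt0 K_compact K_convex K_int0 v0.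
by rewrite -[ltRHS]mul1r ltr_pM2r.
Qed.

Lemma obstacle_le p q : phi p - phi q <= gK (p - q).
Proof.
have [->|/obstacle_lt/ltW//] := eqVneq p q.
by rewrite !subrr gauge_ge0.
Qed.

Lemma boundary_open p : boundary U p -> ~ U p.
Proof. by move=> [_ nU] Up; apply: nU; apply: open_nbhs_nbhs. Qed.

(** The crossing is at the first exit time: openness of [U] puts that point outside [U], while all
    earlier points of the segment lie in [U]. *)
Lemma segment_crosses_boundary p q : U p -> ~ U q ->
  exists2 t, 0 <= t <= 1 & boundary U ((1 - t) *: p + t *: q).
Proof.
move=> Up Uq; pose c t := (1 - t) *: p + t *: q.
have cE t : c t = p + t *: (q - p).
  by rewrite /c scalerBl scale1r scalerBr addrA addrAC.
have dc s t : c s - c t = (s - t) *: (q - p).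
  by rewrite !cE opprD addrACA subrr add0r -scalerBl.
pose S := [set t : R | 0 <= t <= 1 /\ ~ U (c t)].
have S1 : S 1 by split; [rewrite ler01 lexx | rewrite /c subrr scale0r scale1r add0r].
have iS : has_inf S by split; [exists 1 | exists 0 => t [/andP[]]].
pose t0 := inf S.
have t01 : 0 <= t0 <= 1.
  apply/andP; split; first by apply: lb_le_inf; [exists 1 | move=> t [/andP[]]].
  by apply: ge_inf => //; case: iS.
have near_c t A : nbhs (c t) A -> exists2 r, 0 < r & forall s, `|s - t| < r -> A (c s).
  move=> /nbhs_ballP[r /= r0]; rewrite -ball_normE => rA.
  have d0 : 0 < `|q - p| + 1 by rewrite ltr_pwDr.
  exists (r / (`|q - p| + 1)) => [|s]; first by rewrite divr_gt0.
  rewrite ltr_pdivlMr// => st; apply: rA => /=; rewrite distrC dc normrZ.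
  by rewrite (le_lt_trans _ st)// ler_wpM2l// lerDl.
have Ut s : 0 <= s -> s < t0 -> U (c s).
  move=> s0 st; apply: contrapT => nU; move: (st); rewrite ltNge => /negP; apply.
  apply: ge_inf; first by case: iS.
  by split=> //; rewrite s0/= ltW// (lt_le_trans st)//; case/andP: t01.
have nUt : ~ U (c t0).
  move=> Uc; have [r r0 rU] := near_c _ _ (open_nbhs_nbhs (conj U_open Uc)).
  have [s [s01 nUs] st] := inf_adherent r0 iS.
  have t0s : t0 <= s by apply: ge_inf => //; case: iS.
  by apply: nUs; apply: rU; rewrite ger0_norm ?subr_ge0// ltrBlDl.
have t0p : 0 < t0.
  rewrite lt_neqAle; case/andP: t01 => -> _; rewrite andbT; apply/eqP => t00.
  by apply: nUt; rewrite -t00 /c subr0 scale1r scale0r addr0.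
exists t0 => //; split; last by move=> /interior_subset.
move=> A /near_c[r r0 rA].
pose s := Num.max 0 (t0 - r / 2).
have st : s < t0 by rewrite gt_max t0p ltrBlDr ltrDl divr_gt0.
exists (c s); split; first by apply: Ut => //; rewrite le_max lexx.
apply: rA; rewrite distrC gtr0_norm ?subr_gt0// ltrBlDl.
have : t0 - r / 2 <= s by rewrite le_max lexx orbT.
lra.
Qed.

Lemma rho_has_inf y w : boundary U y ->
  has_inf [set gauge K (w - z) + phi z | z in boundary U].
Proof.
move=> yU; split; first by exists (gK (w - y) + phi y); exists y.
exists (phi w) => _ [z _ <-]; have := obstacle_le w z; lra.
Qed.

Lemma rho_le y w : boundary U y -> rho K U phi w <= gK (w - y) + phi y.
Proof.
move=> yU; apply: ge_inf; last by exists y.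
by have [] := rho_has_inf w yU.
Qed.

Lemma rho_lip y u w : boundary U y -> rho K U phi u <= gK (u - w) + rho K U phi w.
Proof.
move=> yU; rewrite -lerBlDl; apply: lb_le_inf; first by have [] := rho_has_inf w yU.
move=> _ [z zU <-]; rewrite lerBlDl addrA (le_trans (rho_le u zU))// lerD2r.
have := gaugeD K_compact K_convex K_int0 (u - w) (w - z).
by rewrite addrA subrK.
Qed.

Context (x y : V) (xU : U x) (xy : rho_closest K U phi x y).
Let T := gK (x - y).
Let z0 := T^-1 *: (x - y).
Let zt t := y + t *: (x - y).

Lemma closest_boundary : boundary U y. Proof. by case: xy. Qed.

Lemma rho_closestE : rho K U phi x = T + phi y. Proof. by case: xy. Qed.

Lemma sub_closest_neq0 : x - y != 0.
Proof.
by rewrite subr_eq0; apply/eqP => E; apply: (boundary_open closest_boundary); rewrite -E.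
Qed.

Lemma gauge_sub_closest_gt0 : 0 < T. Proof. by apply: gauge_gt0 => //; exact: sub_closest_neq0. Qed.

Lemma sub_closestE : x - y = T *: z0.
Proof. by rewrite /z0 scalerA divff ?scale1r// gt_eqF// gauge_sub_closest_gt0. Qed.

Lemma gauge_direction : gK z0 = 1.
Proof. by rewrite gaugeZ// ?invr_ge0 ?mulVf// ?gt_eqF ?ltW// gauge_sub_closest_gt0. Qed.

Lemma direction_boundary : boundary K z0.
Proof. by apply: gauge1_boundary => //; exact: gauge_direction. Qed.

Lemma segment_sub_closest t : zt t - y = t *: (x - y).
Proof. by rewrite /zt addrAC subrr add0r. Qed.

Lemma sub_segment t : x - zt t = (1 - t) *: (x - y).
Proof. by rewrite /zt opprD addrA scalerBl scale1r. Qed.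

Lemma rho_segment t : 0 <= t <= 1 -> rho K U phi (zt t) = t * T + phi y.
Proof.
move=> /andP[t0 t1]; apply/eqP; rewrite eq_le; apply/andP; split.
  by rewrite (le_trans (rho_le (zt t) closest_boundary))// segment_sub_closest gaugeZ.
have := rho_lip x (zt t) closest_boundary.
rewrite rho_closestE sub_segment gaugeZ ?subr_ge0// -/T; lra.
Qed.

(** Otherwise the segment from [x] would meet the boundary of [U] at some [zt t'] with t' > 0, and
    [obstacle_lt] would make that point strictly better for [x] than [y]. *)
Lemma segment_interior t : 0 < t <= 1 -> U (zt t).
Proof.
move=> /andP[t0 t1]; apply: contrapT => nU.
have [s /andP[s0 s1]] := segment_crosses_boundary xU nU.
have -> : (1 - s) *: x + s *: zt t = zt (1 - s + s * t).
  by apply/rowP => i; rewrite /zt !mxE; ring.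
set t' := 1 - s + s * t => wU.
have t'0 : 0 < t' by rewrite /t'; nra.
have t'1 : t' <= 1 by rewrite /t'; nra.
have := rho_le x wU; rewrite rho_closestE sub_segment gaugeZ ?subr_ge0// -/T.
have : phi (zt t') - phi y < gK (zt t' - y).
  apply: obstacle_lt; rewrite -subr_eq0 segment_sub_closest scaler_eq0 negb_or.
  by rewrite sub_closest_neq0 andbT gt_eqF.
rewrite segment_sub_closest gaugeZ ?(ltW t'0)// -/T; lra.
Qed.

Lemma rho_ge_level s k t : 0 <= t <= 1 -> K k ->
  rho K U phi (zt t) <= rho K U phi (x - ((1 - t) * T) *: k).
Proof.
move=> /andP[t0 t1] Kk; rewrite rho_segment ?t0//.
have := rho_lip x (x - ((1 - t) * T) *: k) closest_boundary.
have -> : x - (x - ((1 - t) * T) *: k) = ((1 - t) * T) *: k by rewrite opprB addrC subrK.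
rewrite rho_closestE; have : gK (((1 - t) * T) *: k) <= (1 - t) * T.
  by apply: gauge_leZ => //; rewrite mulr_ge0 ?subr_ge0// ltW// gauge_sub_closest_gt0.
lra.
Qed.

(** Optimality of [y] for [x] forces equality in the triangle inequality through [zt t], so
    [gaugeD_eq] puts [y'] on the line through [x] and [y]. There the values of [phi] at [y] and [y']
    would differ by exactly a gauge distance, which [obstacle_lt] forbids. *)
Lemma closest_unique t y' : 0 < t < 1 -> rho_closest K U phi (zt t) y' -> y' = y.
Proof.
move=> /andP[t0 t1] [y'U ry'].
have t01 : 0 <= t <= 1 by rewrite !ltW.
have zy'0 : zt t - y' != 0.
  rewrite subr_eq0; apply/eqP => E; apply: (boundary_open y'U); rewrite -E.
  by apply: segment_interior; rewrite t0 ltW.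
have xz0 : x - zt t != 0.
  by rewrite sub_segment scaler_eq0 negb_or sub_closest_neq0 andbT subr_eq0 gt_eqF.
have gxz : gK (x - zt t) = (1 - t) * T by rewrite sub_segment gaugeZ// subr_ge0 ltW.
rewrite rho_segment// in ry'.
have sum : gK (x - zt t + (zt t - y')) = gK (x - zt t) + gK (zt t - y').
  apply/eqP; rewrite eq_le gaugeD//=.
  have := rho_le x y'U; rewrite rho_closestE gxz addrA subrK; lra.
have := gaugeD_eq K_compact K_convex K_int0 K_smooth K_curvature xz0 zy'0 sum.
set g' := gK (zt t - y') in ry' *.
have g'0 : 0 < g' by exact: gauge_gt0.
rewrite gxz sub_segment scalerA invfM.
have -> : (1 - t)^-1 / T * (1 - t) = T^-1.
  by rewrite mulrAC mulVf ?mul1r// subr_eq0 gt_eqF.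
rewrite -/z0 => E.
have Ey' : zt t - y' = g' *: z0 by rewrite E scalerA divff ?scale1r// gt_eqF.
have Ey : zt t - y = (t * T) *: z0 by rewrite segment_sub_closest sub_closestE scalerA.
have dy : y' - y = (t * T - g') *: z0.
  by rewrite scalerBl -Ey -Ey'; apply/rowP => i; rewrite !mxE; ring.
apply/eqP; apply: contraT => yy'.
(* [gauge K] is not assumed symmetric, so the two orders on the line are separate cases. *)
have [le|le] := leP g' (t * T).
  have := obstacle_lt yy'; rewrite dy gaugeZ ?subr_ge0// gauge_direction; lra.
have := obstacle_lt (p := y) (q := y'); rewrite eq_sym => /(_ yy').
have -> : y - y' = (g' - t * T) *: z0 by rewrite -opprB dy -scaleNr opprB.
rewrite gaugeZ ?subr_ge0 ?(ltW le)// gauge_direction; lra.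
Qed.

Context (m : V) (J : 'M[R]_n).
Context (m_z0 : argmax K m = z0) (mz1 : dotp m z0 = 1) (mJ : has_jac (argmax K) m J).
Context (m_unique : forall N : V, (forall k, K k -> 0 <= dotp N (z0 - k)) ->
  dotp N z0 = 1 -> N = m).
Context (m_inside : forall d, dotp m d < 0 ->
  exists2 r, 0 < r & forall s, 0 < s < r -> K (z0 + s *: d)).

Lemma polar_gauge_conormal : h m = 1.
Proof. by rewrite (polar_gauge_argmax K_compact K_int0) m_z0. Qed.

Lemma ler_sub_eps (a b : R) : (forall e, 0 < e -> a - b <= e) -> a <= b.
Proof. by move=> H; apply/ler_addgt0Pr => e /H; rewrite lerBlDl. Qed.

(** By [rho_ge_level], [g] supports [K] at [z0]; the unit rate of growth of [rho] along the segment
    gives [dotp g z0 = 1], and the conormal is unique. *)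
Lemma grad_rho_segment t g : 0 < t < 1 -> has_grad (rho K U phi) (zt t) g -> g = m.
Proof.
move=> /andP[t0 t1] rg; have T0 := gauge_sub_closest_gt0.
have t01 : 0 <= t <= 1 by rewrite !ltW.
apply: m_unique => [k Kk|].
  apply: ler_sub_eps => e e0; rewrite sub0r.
  have [r r0 H] := has_grad_line (z0 - k) rg e0.
  pose c := (1 - t) * T; have c0 : 0 < c by rewrite mulr_gt0// subr_gt0.
  pose s := Num.min r c / 2.
  have m0 : 0 < Num.min r c by rewrite lt_min r0.
  have s0 : 0 < s by rewrite divr_gt0.
  have : s < Num.min r c by rewrite ltr_pdivrMr// ltr_pMr// ltr1n.
  rewrite lt_min => /andP[sr sc].
  have := H s; rewrite s0 sr => /(_ isT).
  (* With weight [s / c] the competitor becomes exactly [zt t + s *: (z0 - k)], a straight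
     displacement. *)
  have sc1 : 0 <= s / c <= 1 by rewrite divr_ge0 ?(ltW s0) ?(ltW c0)//= ler_pdivrMr// mul1r ltW.
  have := rho_ge_level 0 t01
    (body_conv K_convex sc1 (boundary_body K_compact direction_boundary) Kk).
  have -> : x - ((1 - t) * T) *: ((1 - s / c) *: z0 + (s / c) *: k) = zt t + s *: (z0 - k).
    have -> : x = zt t + c *: z0 by rewrite /c -scalerA -sub_closestE -sub_segment addrC subrK.
    have cs : c * (s / c) = s by rewrite mulrCA divff ?mulr1// gt_eqF.
    rewrite -/c scalerDr (scalerA c (1 - s / c) z0) (scalerA c (s / c) k) mulrBr mulr1 cs.
    exact: add_scale_conv.
  rewrite ler_norml => Hs /andP[_ H2].
  have : - (s * dotp g (z0 - k)) <= s * e.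
    by apply: le_trans H2; rewrite -[leLHS]add0r lerD2r subr_ge0.
  by rewrite -mulrN ler_pM2l.
suff H1 e : 0 < e -> `|1 - dotp g z0| <= e.
  apply/eqP; rewrite eq_sym -subr_eq0 -normr_eq0 eq_le normr_ge0 andbT.
  by apply: ler_sub_eps => e /H1; rewrite subr0.
move=> e0; have [r r0 H] := has_grad_line z0 rg e0.
pose c := (1 - t) * T; have c0 : 0 < c by rewrite mulr_gt0// subr_gt0.
pose s := Num.min r c / 2.
have m0 : 0 < Num.min r c by rewrite lt_min r0.
have s0 : 0 < s by rewrite divr_gt0.
have : s < Num.min r c by rewrite ltr_pdivrMr// ltr_pMr// ltr1n.
rewrite lt_min => /andP[sr sc].
have := H s; rewrite s0 sr => /(_ isT).
have -> : zt t + s *: z0 = zt (t + s / T) by rewrite /zt /z0 scalerA -addrA -scalerDl.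
have ts : 0 <= t + s / T <= 1.
  apply/andP; split; first by rewrite addr_ge0 ?divr_ge0 ?ltW.
  by rewrite -lerBrDl ler_pdivrMr// ltW.
rewrite !rho_segment// mulrDl divfK ?gt_eqF//.
have -> : t * T + s + phi y - (t * T + phi y) - s * dotp g z0 = s * (1 - dotp g z0) by ring.
by rewrite normrM gtr0_norm// ler_pM2l.
Qed.

(* The path w(s) = x - (1 - t) T argmax (m - s v) stays in {w | gK (x - w) <= (1 - t) T},
   on which rho is minimal at zt t by rho_ge_level. *)
Lemma second_order_segment t (H : 'M[R]_n) v : 0 < t < 1 ->
  (\forall q \near zt t, has_grad (rho K U phi) q (grad (rho K U phi) q)) ->
  has_jac (grad (rho K U phi)) (zt t) H ->
  0 <= dotp (v *m J) v + (1 - t) * T * dotp ((v *m J) *m H) (v *m J).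
Proof.
move=> /[dup] t01' /andP[t0 t1] rg rH; set w := v *m J; set c := (1 - t) * T.
have t01 : 0 <= t <= 1 by rewrite !ltW.
have c0 : 0 < c by rewrite mulr_gt0 ?gauge_sub_closest_gt0// subr_gt0.
have gm : grad (rho K U phi) (zt t) = m.
  by apply: (grad_rho_segment t01'); exact: nbhs_singleton rg.
(* [s *: D s] is the displacement of the path from [zt t]. *)
pose D s := (- c) *: (s^-1 *: (argmax K (m + s *: (- v)) - argmax K m)).
have Dlim : D s @[s --> (0 : R)^'] --> c *: w.
  have -> : c *: w = (- c) *: ((- v) *m J) by rewrite mulNmx scaleNr scalerN opprK.
  by apply: cvgZl_tmp; apply: has_jac_cvg.
have rD : \forall q \near zt t, forall d,
    is_derive q d (rho K U phi) (dotp (grad (rho K U phi) q) d).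
  by apply: filterS rg => q qg d; exact: has_grad_is_derive.
have L1 := taylor2_cvg rD rH Dlim.
have L2 := polar_gauge_cvg K_compact K_convex K_int0 K_smooth K_curvature (dotp1_neq0 mz1) mJ
  (a := - v).
have L3 : dotp v (D s) @[s --> (0 : R)^'] --> dotp v (c *: w).
  by apply: cvg_dotp; [exact: cvg_cst | exact: Dlim].
have L5 : c * ((h (m + s *: (- v)) - h m - s * dotp (argmax K m) (- v)) / s ^+ 2)
    @[s --> (0 : R)^'] --> c * (2^-1 * dotp ((- v) *m J) (- v)).
  by apply: cvgMl_tmp; exact: L2.
have L4 := cvgB (cvgD L1 L3) L5.
suff : 0 <= 2^-1 * dotp ((c *: w) *m H) (c *: w) + dotp v (c *: w) -
    c * (2^-1 * dotp ((- v) *m J) (- v)).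
  rewrite mulNmx -/w -scalemxAl dotpNl !dotpNr opprK !dotpZl !dotpZr (dotpC v w).
  have -> : 2^-1 * (c * (c * dotp (w *m H) w)) + c * dotp w v - c * (2^-1 * dotp w v) =
    c * 2^-1 * (dotp w v + c * dotp (w *m H) w) by field.
  by rewrite pmulr_rge0// mulr_gt0.
refine (cvg_ge0 _ (L4 _ _)) => s s0; rewrite !fctE gm.
have [Kz zm] := argmaxP K_compact K_int0 (m + s *: (- v)).
have := polar_gauge_argmax K_compact K_int0 (m + s *: (- v)).
have sD : s *: D s = c *: (z0 - argmax K (m + s *: (- v))).
  rewrite /D m_z0 scalerA mulrC -scalerA scalerA mulrC scalerA.
  rewrite -[_ *: (_ - _)]opprK -scalerN opprB -scaleNr; congr (_ *: _); field; exact: s0.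
have mD : s * dotp m (D s) = c * (1 - dotp m (argmax K (m + s *: (- v)))).
  by rewrite -dotpZr sD dotpZr dotpBr mz1.
have vD : s * dotp v (D s) = c * (dotp v z0 - dotp v (argmax K (m + s *: (- v)))).
  by rewrite -dotpZr sD dotpZr dotpBr.
have := rho_ge_level 0 t01 Kz.
have -> : x - ((1 - t) * T) *: argmax K (m + s *: - v) = zt t + s *: D s.
  rewrite sD scalerBr -/c.
  have -> : x = zt t + c *: z0 by rewrite /c -scalerA -sub_closestE -sub_segment addrC subrK.
  by rewrite addrA.
rewrite m_z0 polar_gauge_conormal dotpDl dotpZl !dotpNl dotpNr (dotpC z0 v).
set z := argmax K _ => Hr Eh.
move: mD vD Hr Eh; rewrite -/z.
move: (rho K U phi (zt t + s *: D s)) (rho K U phi (zt t)) (dotp m (D s)) (dotp v (D s)).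
move: (h (m + s *: - v)) (dotp v z0) (dotp v z) (dotp m z).
by move=> *; apply: second_order_quotient_ge0; eassumption.
Qed.

(** The segment from [x] to [q] meets the boundary at some [w]; the gauge is additive along it, and
    [obstacle_le] pays for the rest from [w] to [q]. *)
Lemma rho_le_outside q : ~ U q -> rho K U phi x <= gK (x - q) + phi q.
Proof.
move=> nUq; have [t /andP[t0 t1] wU] := segment_crosses_boundary xU nUq.
set w := _ + _ in wU.
have xw : x - w = t *: (x - q) by apply/rowP => i; rewrite !mxE; ring.
have wq : w - q = (1 - t) *: (x - q) by apply/rowP => i; rewrite !mxE; ring.
have := rho_le x wU; have := obstacle_le w q.
rewrite xw wq !gaugeZ ?subr_ge0//; lra.
Qed.

(** A one-sided form of the fact that [m] is the gradient of [gauge K] at [x - y]: the direction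
    [d - tau *: z0] enters [K] at [z0], and rescaling by T + s tau transports this to [x - y]. *)
Lemma gauge_line_le d tau : dotp m d < tau -> exists2 r, 0 < r &
  forall s, 0 < s < r -> 0 < T + s * tau -> gK ((x - y) + s *: d) <= T + s * tau.
Proof.
move=> md; have T0 := gauge_sub_closest_gt0.
have [|r r0 H] := m_inside (d := d - tau *: z0).
  by rewrite dotpBr dotpZr mz1 mulr1 subr_lt0.
have c0 : 0 < 1 + r * `|tau| by rewrite ltr_pwDl// mulr_ge0// ltW.
(* Solves s < r (T - s |tau|), so the rescaled step s' stays below r even for negative tau. *)
exists (r * T / (1 + r * `|tau|)); first by rewrite divr_gt0// mulr_gt0.
move=> s /andP[s0 sr] Ts.
pose s' := s / (T + s * tau).
have s'0 : 0 < s' by rewrite divr_gt0.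
have s'r : s' < r.
  rewrite ltr_pdivrMr//; move: sr; rewrite ltr_pdivlMr// => sr.
  have : - tau <= `|tau| by rewrite -normrN ler_norm.
  have : 0 < s * r by rewrite mulr_gt0.
  nra.
have -> : (x - y) + s *: d = (T + s * tau) *: (z0 + s' *: (d - tau *: z0)).
  have Ts' : (T + s * tau) * s' = s by rewrite mulrC divfK// gt_eqF.
  rewrite scalerDr (scalerA _ s' (d - tau *: z0)) Ts' sub_closestE.
  exact: scale_shift.
by apply: gauge_le => //; apply: H; rewrite s'0.
Qed.

(* m - grad phi y is a multiple of the normal to U at y because, by rho_le_outside, y minimizes
   gK (x - q) + phi q over all q outside U, and not only over the boundary. *)
Lemma multiplier_dir f d : defines U f y -> has_grad f y (grad f y) ->
  0 < dotp (grad f y) d -> 0 <= dotp (m - grad phi y) d.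
Proof.
move=> fy fg gd; rewrite leNgt dotpBl subr_lt0; apply/negP => md.
have T0 := gauge_sub_closest_gt0.
(* The midpoint leaves room on both sides for the first-order errors of the gauge and of [phi]. *)
pose tau := (dotp m d + dotp (grad phi y) d) / 2.
have mt : dotp m d < tau by rewrite /tau; lra.
have tp : 0 < dotp (grad phi y) d - tau by rewrite /tau; lra.
have [r1 r10 H1] := gauge_line_le mt.
have e2 : 0 < (dotp (grad phi y) d - tau) / 2 by rewrite divr_gt0.
have [r2 r20 H2] := has_grad_line (- d) (phi_has_grad y) e2.
have e3 : 0 < dotp (grad f y) d / 2 by rewrite divr_gt0.
have [r3 r30 H3] := has_grad_line (- d) fg e3.
have /near_norm_addr/near0_ball[r4 r40 H4] := fy.
have d1 : 0 < `|d| + 1 by rewrite ltr_pwDr.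
have t1 : 0 < `|tau| + 1 by rewrite ltr_pwDr.
pose r := Num.min (Num.min r1 r2) (Num.min r3 (Num.min (r4 / (`|d| + 1)) (T / (`|tau| + 1)))).
have r0 : 0 < r by rewrite !lt_min r10 r20 r30 !divr_gt0.
pose s := r / 2.
have s0 : 0 < s by rewrite divr_gt0.
have : s < r by rewrite ltr_pdivrMr// ltr_pMr// ltr1n.
rewrite !lt_min => /andP[/andP[s1 s2] /and3P[s3 s4 s5]].
rewrite !ltr_pdivlMr// in s4 s5.
have Ts : 0 < T + s * tau.
  have : - (s * `|tau|) <= s * tau.
    by rewrite -mulrN ler_pM2l// lerNl -normrN ler_norm.
  move: s5; rewrite mulrDr mulr1; lra.
have := H1 s; rewrite s0 s1 => /(_ isT Ts).
have := H2 s; rewrite s0 s2 => /(_ isT).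
have := H3 s; rewrite s0 s3 => /(_ isT).
have f0 : f y = 0 by have /nbhs_singleton[_ [+ _]] := fy; apply; exact: closest_boundary.
rewrite f0 subr0 !dotpNr !ler_norml => /andP[_ fneg] /andP[_ phiq] gq.
(* [f] is negative at this point, so it is an admissible competitor outside [U]. *)
have nU : ~ U (y + s *: - d).
  move=> Uq; have : U° (y + s *: - d) by apply: open_nbhs_nbhs.
  have /H4[+ _] : `|s *: - d| < r4.
    rewrite normrZ normrN gtr0_norm//; apply: le_lt_trans s4.
    by rewrite ler_pM2l// lerDl.
  move=> -> fpos; have : 0 < s * (dotp (grad f y) d / 2) by rewrite mulr_gt0.
  lra.
have := rho_le_outside nU; rewrite rho_closestE.
have -> : x - (y + s *: - d) = x - y + s *: d by rewrite scalerN opprB addrA addrAC.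
have : 0 < s * ((dotp (grad phi y) d - tau) / 2) by rewrite mulr_gt0.
move: phiq gq; lra.
Qed.

Context (U_smooth : exists f, local_defining_function 1 0 U y f).

(** If l1 < l2, the first point lies strictly between [p], where the polar gauge is below 1, and the
    second point; convexity puts its value below 1. *)
Lemma polar_gauge_ray_unique p q (l1 l2 : R) : h p < 1 -> 0 < l1 -> 0 < l2 ->
  h (p + l1 *: q) = 1 -> h (p + l2 *: q) = 1 -> l1 = l2.
Proof.
move=> hp; wlog le12 : l1 l2 / l1 <= l2.
  move=> W l10 l20 h1 h2; have [/W|/ltW/W] := leP l1 l2; first exact.
  by move=> E; apply/esym/E.
move=> l10 l20 h1 h2; apply/eqP; rewrite eq_le le12/= leNgt; apply/negP => lt12.
pose t := l1 / l2.
have t0 : 0 < t by rewrite divr_gt0.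
have t1 : t < 1 by rewrite ltr_pdivrMr// mul1r.
have t01 : 0 <= t <= 1 by rewrite !ltW.
have := polar_gauge_conv K_compact K_int0 p (p + l2 *: q) t01.
have -> : (1 - t) *: p + t *: (p + l2 *: q) = p + l1 *: q.
  by rewrite scalerDr scalerA divfK ?gt_eqF// addrA -scalerDl subrK scale1r.
rewrite h1 h2; nra.
Qed.

(** The multiplier from [halfspace_sub] is positive because [h m = 1] exceeds the polar gauge of
    [grad phi y]; [polar_gauge_ray_unique] then identifies it, after scaling by the length of the
    gradient, with the chosen [lambda]. *)
Lemma mu_conormal : mu K U phi y = m.
Proof.
(* Taking the defining function behind the chosen value of [nu] makes its gradient a positive
   multiple of [nu U y] at once. *)
have [f [r r0 [hf gf Uf bf]] nuE] : is_inward_unit_normal U y (nu U y).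
  rewrite /nu; case: xgetP => [v -> //|no]; have [f ff] := U_smooth.
  by exfalso; apply: (no (normalize (grad f y))); exists f.
have fg : has_grad f y (grad f y).
  by apply: (holder_class_has_grad _ _ hf); [exact: ball_open | exact: ballxx].
have fy : defines U f y.
  by apply: filterS (nbhsx_ballx y r r0) => w Bw; split; [exact: Uf | exact: bf].
have [|c c0 E] := halfspace_sub (N := m - grad phi y) gf.
  by move=> d; exact: multiplier_dir.
have en := enorm_gt0 gf.
have mE : m = grad phi y + (c * enorm (grad f y)) *: nu U y.
  rewrite nuE /normalize scalerA mulfK ?gt_eqF// -E addrC subrK //.
have l0 : 0 < c * enorm (grad f y).
  rewrite mulr_gt0// lt_neqAle c0 andbT; apply/eqP => c0'.
  have := phi_grad y; have := polar_gauge_conormal.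
  have -> : m = grad phi y by apply/eqP; rewrite -subr_eq0 E -c0' scale0r.
  by move=> ->; rewrite ltxx.
rewrite /mu [RHS]mE; congr (_ + _ *: _).
rewrite /lambda; case: xgetP => [l _ [lp hl]|no].
  apply: (polar_gauge_ray_unique (phi_grad y) lp l0 hl).
  by rewrite -mE polar_gauge_conormal.
exfalso; apply: (no (c * enorm (grad f y))); split=> //.
by rewrite -mE polar_gauge_conormal.
Qed.

End obstacle.

(** * Passage to the boundary point and the final bounds *)

Lemma cvg_mulmxr {R : realType} {n : nat} {T : Type} {F : set_system T} {FF : Filter F}
    (w : 'rV[R]_n) (M : T -> 'M[R]_n) (H : 'M[R]_n) :
  M t @[t --> F] --> H -> (w *m M t : 'rV[R]_n) @[t --> F] --> w *m H.
Proof.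
move=> MH; apply/cvgrPdist_le => e e0.
have C0 : 0 < n%:R * `|w| + 1 by rewrite ltr_pwDr// mulr_ge0.
move/cvgrPdist_le : MH => /(_ _ (divr_gt0 e0 C0)); apply: filterS => t.
rewrite ler_pdivlMr// -mulmxBr => Ht; apply: le_trans Ht.
by rewrite (le_trans (norm_mulmx _ _))// mulrDr mulr1 mulrC lerDl.
Qed.

Theorem theorem7 (R : realType) (n k : nat) (alpha : R)
    (K U : set 'rV[R]_n) (phi : 'rV[R]_n -> R)
    (hk : (2 <= k)%N) (halpha : 0 <= alpha <= 1)
    (K_compact : compact K) (K_convex : convex_set K) (K_int0 : K° 0)
    (K_boundary : holder_boundary k alpha K)
    (K_curvature : forall p c, boundary K p -> is_principal_curvature K p c -> 0 < c)
    (U_open : open U) (U_bounded : bounded_set U)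
    (U_boundary : holder_boundary k alpha U)
    (phi_smooth : holder_class k alpha setT phi)
    (phi_grad : forall z, gauge (polar K) (grad phi z) < 1)
    (x y : 'rV[R]_n) (xU : U x) (xy_closest : rho_closest K U phi x y) :
  (forall c : R, eigenvalue (W K U phi y) c ->
     forall z, open_segment x y z ->
       c * (rho K U phi z - phi y) = c * gauge K (z - y) /\
       c * gauge K (z - y) < 1) /\
  (forall z, open_segment x y z ->
     \det (Q K U phi z) = \det (1%:M - gauge K (z - y) *: W K U phi y) /\
     0 < \det (1%:M - gauge K (z - y) *: W K U phi y)).
Proof.
have K_smooth p : boundary K p -> exists f, local_defining_function 2 0 K p f.
  by move=> /K_boundary[f fK]; exists f; exact: local_defining_function_le fK.
have phi_has_grad p : has_grad phi p (grad phi p).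
  by apply: (holder_class_has_grad openT _ (holder_class_le (ltnW hk) phi_smooth)).
have U_smooth : exists f, local_defining_function 1 0 U y f.
  have [f fU] := U_boundary _ (closest_boundary xy_closest).
  by exists f; exact: local_defining_function_le (ltnW hk) fU.
have T0 := gauge_sub_closest_gt0 K_compact K_convex K_int0 U_open xU xy_closest.
set T := gauge K (x - y) in T0.
have [m [J [m_z0 mz1 mJ m_unique m_inside]]] := gauss_map K_compact K_convex K_int0 K_smooth
  K_curvature (direction_boundary K_compact K_convex K_int0 U_open xU xy_closest).
have m0 : m != 0 by exact: dotp1_neq0 mz1.
have WE : W K U phi y = - J *m hess_rho K U phi y.
  rewrite /W; congr (- _ *m _).
  rewrite (mu_conormal K_compact K_convex K_int0 U_open phi_has_grad phi_grad xU xy_closest m_z0 mz1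
    m_inside U_smooth).
  exact: hess_polar_gauge mJ.
have seg t : 0 <= t <= 1 -> rho K U phi (y + t *: (x - y)) = t * T + phi y.
  exact: rho_segment.
have cT c : eigenvalue (W K U phi y) c -> 0 < c -> c * T <= 1.
  (* Eigenvectors are rows, so the factor [J] of [W] meets [v] first and [w] is the vector at which
     the Hessian of [rho] gets evaluated. *)
  move=> /eigenvalueP[v vW v0] c0; rewrite WE mulmxA mulmxN in vW.
  set w := v *m J in vW.
  have w0 : w != 0.
    apply: contra_neq v0 => w0; move: vW; rewrite w0 oppr0 mul0mx => /esym/eqP.
    by rewrite scaler_eq0 gt_eqF//= => /eqP.
  have q0 : 0 < dotp w v.
    rewrite lt_neqAle (quad_ge0 K_compact K_convex K_int0 K_smooth K_curvature m0 mJ) andbT.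
    apply: contra_neq w0 => /esym.
    exact: (quad_eq0 K_compact K_convex K_int0 K_smooth K_curvature m0 mJ).
  (* Without a boundary Hessian at y, hess_rho is the junk value 0 and then W = 0. *)
  move: vW; rewrite /hess_rho; case: xgetP => [H _ [[r r0 rhoC] rhoH]|_]; last first.
    rewrite mulmx0 => /esym/eqP; rewrite scaler_eq0 gt_eqF//= => v0'.
    by rewrite v0' in v0.
  rewrite mulNmx => wH.
  (* The boundary Hessian is a limit within [U]; the segment is an admissible approach to [y] by
     [segment_interior]. *)
  have zty : (y + t *: (x - y)) @[t --> (0 : R)^'+] --> within U (nbhs y).
    have zy : (y + t *: (x - y) : 'rV[R]_n) @[t --> (0 : R)] --> y.
      suff : (y + t *: (x - y) : 'rV[R]_n) @[t --> (0 : R)] --> y + 0 *: (x - y).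
        by rewrite scale0r addr0.
      by apply: cvgD; [exact: cvg_cst | apply: cvgZr_tmp; exact: cvg_id].
    move=> A /= /zy zA; have {}zA : \forall t \near (0 : R)^'+, U (y + t *: (x - y)) ->
        A (y + t *: (x - y)) by exact: cvg_at_right_filter zA.
    suff : \forall t \near (0 : R)^'+, A (y + t *: (x - y)) by [].
    near=> t; have UA : U (y + t *: (x - y)) -> A (y + t *: (x - y)) by near: t.
    apply: UA; apply: (segment_interior K_compact K_convex K_int0 U_open phi_has_grad
      phi_grad xU xy_closest); apply/andP; split.
      by near: t; exact: nbhs_right_gt.
    by near: t; exact: nbhs_right_le.
  have near_ineq : \forall t \near (0 : R)^'+,
      0 <= dotp w v + (1 - t) * T * dotp (w *m hess (rho K U phi) (y + t *: (x - y))) w.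
    have yB : within U (nbhs y) (U `&` ball y r).
      by apply: filterS (nbhsx_ballx y r r0) => q Bq Uq.
    have t1 : \forall t \near (0 : R)^'+, t < 1 by exact: nbhs_right_lt.
    have tp : \forall t \near (0 : R)^'+, 0 < t by exact: nbhs_right_gt.
    have UB : open (U `&` ball y r) by apply: openI => //; exact: ball_open.
    have nB : \forall t \near (0 : R)^'+, (U `&` ball y r) (y + t *: (x - y)).
      exact (zty _ yB).
    apply: filterS3 nB tp t1 => t Bt t0 t1.
    have t01 : 0 < t < 1 by rewrite t0.
    apply: (second_order_segment K_compact K_convex K_int0 K_smooth K_curvature U_open
      phi_has_grad phi_grad xU xy_closest m_z0 mz1 mJ m_unique v t01).
      apply: filterS (open_nbhs_nbhs (conj UB Bt)) => q Bq.
      exact: holder_class_has_grad rhoC.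
    exact: holder_class_has_jac rhoC.
  have : 0 <= dotp w v + (1 - 0) * T * dotp (w *m H) w.
    rewrite leNgt; apply/negP => neg.
    have lim : dotp w v + (1 - t) * T * dotp (w *m hess (rho K U phi) (y + t *: (x - y))) w
        @[t --> (0 : R)^'+] --> dotp w v + (1 - 0) * T * dotp (w *m H) w.
      apply: cvgD; first exact: cvg_cst.
      apply: cvgM.
        apply: cvgMr_tmp; apply: cvgB; first exact: cvg_cst.
        by apply: cvg_at_right_filter; exact: cvg_id.
      apply: cvg_dotp; last exact: cvg_cst.
      by apply: cvg_mulmxr; exact: cvg_comp zty rhoH.
    have nneg : \forall t \near (0 : R)^'+, dotp w v + (1 - t) * T *
        dotp (w *m hess (rho K U phi) (y + t *: (x - y))) w < 0 by exact: (cvgr_lt _ lim).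
    near (0 : R)^'+ => t; have : 0 <= dotp w v + (1 - t) * T *
        dotp (w *m hess (rho K U phi) (y + t *: (x - y))) w by near: t.
    by rewrite leNgt => /negP; apply; near: t.
  have -> : w *m H = - (c *: v) by rewrite -wH opprK.
  rewrite dotpNl dotpZl subr0 mul1r (dotpC v w).
  have -> : dotp w v + T * - (c * dotp w v) = dotp w v * (1 - c * T) by ring.
  by rewrite pmulr_rge0// subr_ge0.
have zE z : open_segment x y z -> exists2 t, 0 < t < 1 & z = y + t *: (x - y).
  move=> [t /= /andP[t0 t1] <-]; exists (1 - t); first by rewrite subr_gt0 t1 gtrBl.
  by apply/rowP => i; rewrite !mxE; ring.
have main c z : eigenvalue (W K U phi y) c -> open_segment x y z -> c * gauge K (z - y) < 1.
  move=> /cT cW /zE[t /andP[t0 t1] ->].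
  rewrite addrAC subrr add0r gaugeZ ?(ltW t0)// -/T.
  have [c0|c0] := leP c 0.
    apply: le_lt_trans ltr01; rewrite mulr_le0_ge0// mulr_ge0// ltW//.
  by apply: lt_le_trans (cW c0); rewrite ltr_pM2l// gtr_pMl.
split=> [c cW z /[dup] zs /zE[t /andP[t0 t1] Ez]|z zs].
  split; last exact: main.
  rewrite Ez seg ?ltW// addrK [y + _]addrC addrK gaugeZ// ltW//.
split; last first.
  apply: det_sub_scale_gt0 => [|c cW]; last exact: main.
  have [t /andP[t0 t1] ->] := zE _ zs.
  by rewrite [y + _]addrC addrK gaugeZ ?(ltW t0)// mulr_gt0.
have [t t01 Ez] := zE _ zs; have /andP[t0 t1] := t01.
have rz : rho K U phi z = gauge K (z - y) + phi y.
  by rewrite Ez seg ?ltW// [y + _]addrC addrK gaugeZ// ltW.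
rewrite /Q.
(* Any selected point equals [y] by [closest_unique], and the default value is excluded because [y]
   itself is closest to [z]. *)
have -> : xget 0 [set y | rho_closest K U phi z y] = y.
  case: xgetP => [y' _ /= y'z|no].
    rewrite Ez in y'z.
    exact: (closest_unique K_compact K_convex K_int0 K_smooth K_curvature U_open phi_has_grad
      phi_grad xU xy_closest t01 y'z).
  by exfalso; apply: (no y); split=> //; exact: closest_boundary xy_closest.
by rewrite rz addrK.
Unshelve. all: by end_near. Qed.
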